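(* Let $K$ be any field, $n\ge 3$, $V$ an $n$-dimensional $K$-vector space, and let $S=\{t_\alpha=1+v_\alpha\otimes\phi_\alpha:\alpha\in I\}\subseteq SL(V)$ be a set of transvections. Then $S^K$ generates $SL(V)$ if and only if $S$ satisfies (P1), (P2) and (P3), or $S$ satisfies (P1), (P2) and (P3').
   Context: A transvection is $1+d\otimes\phi\in SL(V)$ acting by $x\mapsto x+\phi(x)d$, $0\ne d\in V$, $0\neq\phi\in V^*$, $\phi(d)=0$. For $t=1+d\otimes\phi$, $t^K=\{1+\lambda d\otimes\phi:\lambda\in K\}$ and $S^K=\bigcup_{\alpha\in I}t_\alpha^K$. For a set $S$ of transvections, $\Gamma(S)$ is the directed graph on $S\setminus\{1\}$ with an edge from $1+d_1\otimes\phi_1$ to $1+d_2\otimes\phi_2$ iff $\phi_2(d_1)\neq0$; an edge $(r,s)$ is one-way directed if $(s,r)$ is not an edge. A cycle in $\Gamma(S)$ is a sequence of $k\ge3$ distinct vertices $r_1,\ldots,r_k$, $r_i=1+v_i\otimes\phi_i$, with $(r_i,r_{i+1})$ an edge for all $i$ (indices mod $k$); it is non-singular if $\prod_{i=1}^k\phi_i(v_{i+1})+(-1)^{k-1}\prod_{i=1}^k\phi_{i+1}(v_i)\neq0$ (indices mod $k$). The properties are: (P1) $\langle v_\alpha:\alpha\in I\rangle=V$ and $\langle\phi_\alpha:\alpha\in I\rangle=V^*$; (P2) $\Gamma(S)$ is strongly connected; (P3) there is a non-singular cycle in $\Gamma(S)$; (P3') there is a $t$-equivalence $S\to S'$ for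 some $t\ge0$ such that $\Gamma(S')$ contains a one-way directed edge. Here a $t$-equivalence $S\to S'$ is a chain $S=S_0,S_1,\ldots,S_t=S'$ of sets of transvections such that for each $1\le i\le t$ there are $x,y\in S_{i-1}$ with $S_i$ obtained from $S_{i-1}$ by replacing $x$ by $yxy^{-1}$. *)

(* Defs.v *)
(* V = K^n represented as column vectors 'cV[K]_n;
   linear forms are row vectors 'rV[K]_n; d (x) phi is the rank-one matrix d *m phi,
   so 1 + d (x) phi acts on columns by x |-> x + phi(x) d. *)
From HB Require Import structures.
From mathcomp Require Import all_boot all_order all_algebra.
From Stdlib Require Import Relations.Relation_Operators.
Set Implicit Arguments. Unset Strict Implicit. Unset Printing Implicit Defensive.
Import Order.TTheory GRing.Theory Num.Theory.
Local Open Scope ring_scope.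

Section Transvections.
Variables (K : fieldType) (n : nat).

Notation mat := 'M[K]_n.

Definition app (phi : 'rV[K]_n) (v : 'cV[K]_n) : K := (phi *m v) 0 0.

Definition tv (d : 'cV[K]_n) (phi : 'rV[K]_n) : mat := 1%:M + d *m phi.

Definition is_transvection (t : mat) : Prop :=
  exists (d : 'cV[K]_n) (phi : 'rV[K]_n),
    [/\ d != 0, phi != 0, app phi d = 0 & t = tv d phi].

Definition SK (S : mat -> Prop) : mat -> Prop :=
  fun m => exists (d : 'cV[K]_n) (phi : 'rV[K]_n) (lam : K),
    S (tv d phi) /\ m = tv (lam *: d) phi.

Inductive gen (A : mat -> Prop) : mat -> Prop :=
| gen_one : gen A 1%:M
| gen_in a : A a -> gen A a
| gen_mul a b : gen A a -> gen A b -> gen A (a *m b)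
| gen_inv a : gen A a -> gen A (invmx a).

Definition generates_SL (A : mat -> Prop) : Prop :=
  forall m : mat, gen A m <-> \det m = 1.

Definition edge (r s : mat) : Prop :=
  exists (d1 : 'cV[K]_n) (f1 : 'rV[K]_n) (d2 : 'cV[K]_n) (f2 : 'rV[K]_n),
    [/\ r = tv d1 f1, s = tv d2 f2 & app f2 d1 != 0].

Definition vertex (S : mat -> Prop) (r : mat) : Prop := S r /\ r <> 1%:M.

Definition gedge (S : mat -> Prop) (r s : mat) : Prop :=
  [/\ vertex S r, vertex S s & edge r s].

Definition P1 (S : mat -> Prop) : Prop :=
  (forall x : 'cV[K]_n, exists (m : nat) (c : 'I_m -> K)
      (d : 'I_m -> 'cV[K]_n) (f : 'I_m -> 'rV[K]_n),
      (forall i, S (tv (d i) (f i))) /\ x = \sum_(i < m) c i *: d i) /\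
  (forall y : 'rV[K]_n, exists (m : nat) (c : 'I_m -> K)
      (d : 'I_m -> 'cV[K]_n) (f : 'I_m -> 'rV[K]_n),
      (forall i, S (tv (d i) (f i))) /\ y = \sum_(i < m) c i *: f i).

Definition P2 (S : mat -> Prop) : Prop :=
  forall r s, vertex S r -> vertex S s -> clos_refl_trans _ (gedge S) r s.

Definition P3 (S : mat -> Prop) : Prop :=
  exists (k : nat) (v : 'I_k -> 'cV[K]_n) (f : 'I_k -> 'rV[K]_n),
    [/\ (3 <= k)%N,
        forall i, vertex S (tv (v i) (f i)),
        injective (fun i => tv (v i) (f i)),
        forall i, edge (tv (v i) (f i)) (tv (v (ordS i)) (f (ordS i))) &
        \prod_(i < k) app (f i) (v (ordS i))
          + (-1) ^+ k.-1 * \prod_(i < k) app (f (ordS i)) (v i) != 0].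

Definition equiv_step (S T : mat -> Prop) : Prop :=
  exists x y, S x /\ S y /\
    (forall z, T z <-> ((S z /\ z <> x) \/ z = y *m x *m invmx y)).

Definition P3' (S : mat -> Prop) : Prop :=
  exists S', clos_refl_trans _ (@equiv_step) S S' /\
    exists r s, gedge S' r s /\ ~ gedge S' s r.

End Transvections.

(* Main.v *)
(* A symplectic group preserves an alternating form B and its transvections are
   multiples of 1 + v (x) B(v, .), so their graph is symmetric and every cycle
   singular; the point is that nothing else can obstruct generation.

   Call (d, f) a root of G = <S^K> if G contains all 1 + l d (x) f.  Conjugation
   turns a one-way edge from (d1, f1) to (d2, f2) into a new root (d2, f1), so
   the space of d with (d, f1) a root has dimension at least 2.  Choose f for
   which this space W is as large as possible, and a root (u, g) with f(u) <> 0: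
   irreducibility (a consequence of P1 and P2) forces W + <u> to be everything,
   hence W = ker f.  Such full forms propagate along the edges of the graph and
   are closed under sums, so every transvection lies in G.

   If no pair of roots of G is a one-way edge, the ratios -f_j(v_i) / f_i(v_j)
   multiply to 1 along every closed walk, since a walk can be shortened by
   conjugation without changing the product; so a non-singular cycle produces a
   one-way edge of roots.

   Conversely, if the graph of S is symmetric and has no non-singular cycle, a
   shortest closed walk with product different from 1 would be such a cycle, so
   the ratios come from a potential.  Rescaling the forms by it makes
   f_i(v_j) skew, which defines a nonzero bilinear form preserved by G; this is
   impossible for SL_n with n >= 3. *)
Require Import Defs.
From mathcomp Require Import all_boot all_order all_algebra.
From mathcomp Require Import ring.
From Stdlib Require Import Relations.Relation_Operators Classical ClassicalEpsilon.
Set Implicit Arguments. Unset Strict Implicit. Unset Printing Implicit Defensive.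
Import GRing.Theory.
Local Open Scope ring_scope.

(** * Rank-one maps and root elements *)

Section Pairing.
Variables (K : fieldType) (n : nat).
Implicit Types (d e x : 'cV[K]_n) (f g : 'rV[K]_n) (c : K).

Lemma mul_app f d : f *m d = (app f d)%:M.
Proof. by rewrite [LHS]mx11_scalar. Qed.

Lemma appDl f g d : app (f + g) d = app f d + app g d.
Proof. by rewrite /app mulmxDl mxE. Qed.
Lemma appDr f d e : app f (d + e) = app f d + app f e.
Proof. by rewrite /app mulmxDr mxE. Qed.
Lemma appZl c f d : app (c *: f) d = c * app f d.
Proof. by rewrite /app -scalemxAl mxE. Qed.
Lemma appZr c f d : app f (c *: d) = c * app f d.
Proof. by rewrite /app -scalemxAr mxE. Qed.
Lemma appNl f d : app (- f) d = - app f d.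
Proof. by rewrite /app mulNmx mxE. Qed.
Lemma appNr f d : app f (- d) = - app f d.
Proof. by rewrite /app mulmxN mxE. Qed.
Lemma app0l d : app 0 d = 0.
Proof. by rewrite /app mul0mx mxE. Qed.
Lemma app0r f : app f 0 = 0.
Proof. by rewrite /app mulmx0 mxE. Qed.

Definition appE := (appDl, appDr, appZl, appZr, appNl, appNr, app0l, app0r).

Lemma app_suml m (F : 'I_m -> 'rV[K]_n) d :
  app (\sum_i F i) d = \sum_i app (F i) d.
Proof. by rewrite /app mulmx_suml summxE. Qed.

Lemma app_sumr m f (F : 'I_m -> 'cV[K]_n) :
  app f (\sum_i F i) = \sum_i app f (F i).
Proof. by rewrite /app mulmx_sumr summxE. Qed.

Lemma app_delta_r f (i : 'I_n) : app f (delta_mx i 0) = f 0 i.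
Proof.
rewrite /app mxE (bigD1 i) //= big1 => [|j ji]; rewrite !mxE.
  by rewrite !eqxx mulr1 addr0.
by rewrite (negbTE ji) mulr0.
Qed.

Lemma app_delta_l (i : 'I_n) d : app (delta_mx 0 i) d = d i 0.
Proof.
rewrite /app mxE (bigD1 i) //= big1 => [|j ji]; rewrite !mxE.
  by rewrite !eqxx mul1r addr0.
by rewrite (negbTE ji) andbF mul0r.
Qed.

Lemma app_neq0_r f : f != 0 -> exists d, app f d != 0.
Proof.
by case/rV0Pn=> i fi; exists (delta_mx i 0); rewrite app_delta_r.
Qed.

Lemma app_neq0_l d : d != 0 -> exists f, app f d != 0.
Proof.
by case/cV0Pn=> i fi; exists (delta_mx 0 i); rewrite app_delta_l.
Qed.

Lemma app_eq1_r f : f != 0 -> exists d, app f d = 1.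
Proof.
case/app_neq0_r=> d fd; exists ((app f d)^-1 *: d).
by rewrite appZr mulVf.
Qed.

Lemma app_eq1_l d : d != 0 -> exists f, app f d = 1.
Proof.
case/app_neq0_l=> f fd; exists ((app f d)^-1 *: f).
by rewrite appZl mulVf.
Qed.

Lemma app_inj_l f g : (forall d, app f d = app g d) -> f = g.
Proof.
by move=> fg; apply/rowP=> i; rewrite -!app_delta_r.
Qed.

Lemma sub_ker_colinear f g :
  (forall d, app f d = 0 -> app g d = 0) -> exists c, g = c *: f.
Proof.
case: (eqVneq f 0) => [-> gf|f0 gf].
  exists 0; rewrite scaler0; apply: app_inj_l => d.
  by rewrite app0l gf // app0l.
have [e fe] := app_eq1_r f0.
exists (app g e); apply: app_inj_l => d.
have := gf (d - app f d *: e); rewrite !appE fe mulr1 subrr => /(_ erefl) h.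
by apply/eqP; rewrite -subr_eq0 -[X in _ == X]h mulrC.
Qed.

Lemma tv_mulE d f x : tv d f *m x = x + app f x *: d.
Proof.
by rewrite /tv mulmxDl mul1mx -mulmxA mul_app mul_mx_scalar.
Qed.

Lemma mul_tvE d f g : g *m tv d f = g + app g d *: f.
Proof.
by rewrite /tv mulmxDr mulmx1 mulmxA mul_app mul_scalar_mx.
Qed.

Lemma tv0 f : tv (0 : 'cV[K]_n) f = 1%:M.
Proof. by rewrite /tv mul0mx addr0. Qed.

Lemma tvZ c d f : tv (c *: d) f = tv d (c *: f).
Proof. by rewrite /tv -scalemxAl -scalemxAr. Qed.

Lemma tvDl d e f : app f e = 0 -> tv d f *m tv e f = tv (d + e) f.
Proof.
move=> fe; rewrite {1}/tv mulmxDl mul1mx -mulmxA mul_tvE fe scale0r addr0.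
by rewrite /tv -addrA -mulmxDl [e + d]addrC.
Qed.

Lemma tvDr d f g : app f d = 0 -> tv d f *m tv d g = tv d (f + g).
Proof.
move=> fd; rewrite {1}/tv mulmxDl mul1mx -mulmxA mul_tvE fd scale0r addr0.
by rewrite /tv -addrA -mulmxDr [g + f]addrC.
Qed.

Lemma tvNK d f : app f d = 0 -> tv d f *m tv (- d) f = 1%:M.
Proof. by move=> fd; rewrite tvDl ?appE ?fd ?oppr0 // subrr tv0. Qed.

Lemma invmx_tv d f : app f d = 0 -> invmx (tv d f) = tv (- d) f.
Proof.
move=> fd; have h := tvNK fd; have [u _] := mulmx1_unit h.
by rewrite -[RHS]mul1mx -(mulVmx u) -mulmxA h mulmx1.
Qed.

Lemma tv_unit d f : app f d = 0 -> tv d f \in unitmx.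
Proof. by move/tvNK/mulmx1_unit => []. Qed.

Lemma conj_tv (m m' : 'M[K]_n) d f : m *m m' = 1%:M ->
  m *m tv d f *m m' = tv (m *m d) (f *m m').
Proof.
by move=> mm; rewrite /tv mulmxDr mulmx1 mulmxDl mm !mulmxA.
Qed.

(** Sylvester's identity: the block matrix with rows (1, -f) and (d, 1) is factored into
    block-triangular matrices in two ways, and [app f d = 0] turns its upper left entry 1 - f(d)
    into 1. *)
Lemma det_tv d f : app f d = 0 -> \det (tv d f) = 1.
Proof.
move=> fd.
have h : block_mx 1%:M 0 d 1%:M *m block_mx 1%:M (- f) 0 (tv d f)
  = block_mx 1%:M (- f) 0 1%:M *m block_mx (1%:M : 'M[K]_1) 0 d 1%:M.
  rewrite !mulmx_block !mul1mx !mul0mx !mulmx1 !addr0 !add0r.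
  rewrite mulmxN mulNmx mul_app fd raddf0 oppr0 addr0.
  by rewrite /tv addrCA addNr addr0.
have := congr1 determinant h.
by rewrite !det_mulmx !det_lblock !det_ublock !det1 !mul1r.
Qed.

(** Used whenever a property of a matrix in [S] is checked on one of its factorisations: any other
    factorisation differs only by reciprocal scalars. *)
Lemma tv_inj d f d' f' : d' != 0 -> f' != 0 -> tv d f = tv d' f' ->
  exists c, [/\ c != 0, d = c *: d' & f = c^-1 *: f'].
Proof.
move=> d0 f0 /addrI h.
have [e fe] := app_eq1_r f0; have [g ge] := app_eq1_l d0.
have h1 x : app f x *: d = app f' x *: d'.
  by rewrite -!mul_mx_scalar -!mul_app !mulmxA h.
have de : app f e *: d = d' by rewrite h1 fe scale1r.
have fe0 : app f e != 0.
  by apply: contraNneq d0 => z; rewrite -de z scale0r.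
exists (app f e)^-1; split; first by rewrite invr_neq0.
  by rewrite -de scalerA mulVf // scale1r.
rewrite invrK; apply: app_inj_l => x; rewrite appZl.
have := congr1 (app g) (h1 x); rewrite !appZr ge mulr1 => <-.
have : app f e * app g d = 1 by rewrite -appZr de.
by move=> k; rewrite mulrCA k mulr1.
Qed.

End Pairing.

(** * Roots of the generated group and their conjugates *)

Section Roots.
Variables (K : fieldType) (n : nat) (A : 'M[K]_n -> Prop).
Implicit Types (d e x : 'cV[K]_n) (f g : 'rV[K]_n) (c l : K).

(** Zero factors are allowed, so that for a fixed [f] the roots [d] form a subspace. *)
Definition transv_root d f : Prop :=
  app f d = 0 /\ forall l, gen A (tv (l *: d) f).
Local Notation root := transv_root.

Lemma root_Zl c d f : root d f -> root (c *: d) f.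
Proof.
by case=> fd h; split=> [|l]; rewrite ?appE ?fd ?mulr0 // scalerA.
Qed.

Lemma root_Zr c d f : root d f -> root d (c *: f).
Proof.
case=> fd h; split=> [|l]; rewrite ?appE ?fd ?mulr0 //.
by rewrite -tvZ scalerA.
Qed.

Lemma root_Dl d e f : root d f -> root e f -> root (d + e) f.
Proof.
case=> fd hd [fe he]; split=> [|l]; rewrite ?appE ?fd ?fe ?addr0 //.
by rewrite scalerDr -tvDl ?appE ?fe ?mulr0 //; apply: gen_mul.
Qed.

Lemma root_Dr d f g : root d f -> root d g -> root d (f + g).
Proof.
case=> fd hd [fe he]; split=> [|l]; rewrite ?appE ?fd ?fe ?addr0 //.
by rewrite -tvDr ?appE ?fd ?mulr0 //; apply: gen_mul.
Qed.

Lemma root_conj d f e g : root d f -> root e g ->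
  root (d + app g d *: e) (f - app f e *: g).
Proof.
case=> fd hd [ge he]; split.
  by rewrite !appE fd ge; ring.
move=> l; set M := tv _ _.
have h1 : tv e g *m tv (- e) g = 1%:M by apply: tvNK.
suff -> : M = tv e g *m tv (l *: d) f *m tv (- e) g.
  have := he 1; have := he (-1); rewrite scale1r scaleN1r => a b.
  by apply: gen_mul => //; apply: gen_mul.
rewrite conj_tv // tv_mulE mul_tvE /M !appE; congr (tv _ _).
  by rewrite scalerDr !scalerA.
by rewrite scaleNr.
Qed.

(** Conjugating the first root by the second fixes [f1], because f1(d2) = 0, and adds a nonzero
    multiple of [d2] to [d1]; subtracting [d1] leaves [d2] in the root space of [f1]. *)
Lemma root_oneway d1 f1 d2 f2 : root d1 f1 -> root d2 f2 ->
  app f2 d1 != 0 -> app f1 d2 = 0 -> root d2 f1.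
Proof.
move=> r1 r2 n0 e0; have := root_conj r1 r2.
rewrite e0 scale0r subr0 => /root_Dl /(_ (root_Zl (-1) r1)).
rewrite scaleN1r addrAC subrr add0r => /(root_Zl (app f2 d1)^-1).
by rewrite scalerA mulVf // scale1r.
Qed.

End Roots.

(** * Maximal root subspaces *)

Lemma ex_max_nat (P : nat -> Prop) (N : nat) :
  (forall k, P k -> (k <= N)%N) -> forall k0, P k0 ->
  exists k, [/\ (k0 <= k)%N, P k & forall m, P m -> (m <= k)%N].
Proof.
move=> bP k0; have [j] := ubnP (N - k0)%N; elim: j k0 => // j IH k0 lj Pk0.
case: (classic (exists m, P m /\ (k0 < m)%N)) => [[m [Pm km]]|no].
  have [|k [mk Pk mx]] := IH m _ Pm.
    by have := bP m Pm => mN; rewrite (leq_trans (ltn_sub2l (leq_trans km mN) km)).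
  by exists k; split=> //; apply: leq_trans (ltnW km) mk.
exists k0; split=> // m Pm; rewrite leqNgt; apply/negP=> km.
by apply: no; exists m.
Qed.

Section Kernel.
Variables (K : fieldType) (n : nat).
Implicit Types (x d : 'cV[K]_n) (f g : 'rV[K]_n) (U W : {vspace 'cV[K]_n}).

Definition kerv f : {vspace 'cV[K]_n} :=
  lker (linfun (mulmx f : 'cV[K]_n -> 'cV[K]_1)).

Lemma mem_kerv f x : (x \in kerv f) = (app f x == 0).
Proof.
rewrite memv_ker lfunE /= mul_app; apply/eqP/eqP=> [/matrixP /(_ 0 0)|->].
  by rewrite !mxE.
by rewrite raddf0.
Qed.

Lemma leq_dim_capker f U : (\dim U <= (\dim (U :&: kerv f)%VS).+1)%N.
Proof.
rewrite -(limg_ker_dim (linfun (mulmx f : 'cV[K]_n -> 'cV[K]_1)) U).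
rewrite -/(kerv f) -[leqRHS]addn1 leq_add2l.
by apply: leq_trans (dimvS (subvf _)) _; rewrite dimvf /dim /= mul1n.
Qed.

Lemma dim_add_line U x : x \notin U -> \dim (U + <[x]>)%VS = (\dim U).+1.
Proof.
move=> xU; have x0 : x != 0 by apply: contraNneq xU => ->; rewrite mem0v.
rewrite dimv_disjoint_sum; first by rewrite dim_vline x0 addn1.
apply/eqP; rewrite -subv0; apply/subvP=> y; rewrite memv_cap => /andP[yU].
case/vlineP=> c yE; move: yU; rewrite yE.
case: (eqVneq c 0) => [->|c0]; first by rewrite scale0r !mem0v.
by move/(memvZ c^-1); rewrite scalerA mulVf // scale1r (negbTE xU).
Qed.

Lemma mem_add_line U x y : reflect (exists2 u, u \in U & exists c, y = u + c *: x)
  (y \in (U + <[x]>)%VS).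
Proof.
apply: (iffP memv_addP) => [[u uU [v /vlineP[c ->] ->]]|[u uU [c ->]]].
  by exists u => //; exists c.
by exists u => //; exists (c *: x) => //; rewrite memvZ ?memv_line.
Qed.

End Kernel.

Section FullForms.
Variables (K : fieldType) (n : nat) (A : 'M[K]_n -> Prop).
Implicit Types (d e x y z u w : 'cV[K]_n) (f g h : 'rV[K]_n) (c l : K).
Implicit Types (U W D : {vspace 'cV[K]_n}).
Local Notation root := (transv_root A).

(** This is irreducibility: [U] is stable under the root elements of (d, f) exactly when it contains
    [d] or lies in the kernel of [f]. *)
Hypothesis root_irr : forall U, U != 0%VS ->
  (forall d f, root d f -> d \in U \/ forall u, u \in U -> app f u = 0) ->
  forall x, x \in U.
Hypothesis root_span : forall f, f != 0 ->
  exists d g, [/\ root d g, g != 0 & app f d != 0].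

(** Once [k] is the largest possible dimension, [W] is the whole root space of [f], by
    [axis_mem]. *)
Definition axis k f W : Prop :=
  [/\ f != 0, forall x, x \in W -> root x f & \dim W = k].

Section Maximal.
Variable k : nat.
Hypothesis k_gt1 : (1 < k)%N.
Hypothesis k_max : forall (j : nat) f W, axis j f W -> (j <= k)%N.

Lemma axis_mem f W x : axis k f W -> root x f -> x \in W.
Proof.
case=> f0 Wf dW xf; apply/negPn/negP=> xW.
suff /k_max : axis k.+1 f (W + <[x]>)%VS by rewrite ltnn.
split=> //; last by rewrite dim_add_line // dW.
move=> y /mem_add_line[v vW [c ->]]; apply: root_Dl; first exact: Wf.
exact: root_Zl.
Qed.

Lemma axis_app0 f W x : axis k f W -> x \in W -> app f x = 0.
Proof. by case=> _ Wf _ /Wf[]. Qed.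

Lemma axis_Z c f W : c != 0 -> axis k f W -> axis k (c *: f) W.
Proof.
move=> c0 [f0 Wf dW]; split=> //; first by rewrite scaler_eq0 negb_or c0.
by move=> x /Wf; apply: root_Zr.
Qed.

(** The edge from (w, f) to (u, g) is one-way, so [u] is a root vector of [f], and maximality puts
    it in [W]. *)
Lemma axis_absorb f W u g w : axis k f W -> root u g -> app f u = 0 ->
  w \in W -> app g w != 0 -> u \in W.
Proof.
move=> fW ug fu wW gw; apply: axis_mem (fW) _.
by apply: root_oneway ug gw fu; case: fW => _ + _; apply.
Qed.

(** Every x in W with g(x) = 0 receives a one-way edge from (u, g), hence is a root vector of [g].
    Together with [u] these vectors span dimension at least [k], as cutting by a kernel loses at
    most one. Maximality gives equality, so [g] cannot vanish on [W]. *)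
Lemma axis_move f W u g : axis k f W -> root u g -> g != 0 -> app f u != 0 ->
  (exists2 w, w \in W & app g w != 0) /\
  axis k g ((W :&: kerv g) + <[u]>)%VS.
Proof.
move=> fW ug g0 fu; have [f0 Wf dW] := fW.
have rt y : y \in ((W :&: kerv g) + <[u]>)%VS -> root y g.
  case/mem_add_line=> x; rewrite memv_cap mem_kerv => /andP[xW /eqP gx] [c ->].
  by apply: root_Dl (root_Zl _ ug); apply: root_oneway ug (Wf x xW) fu gx.
have uW : u \notin (W :&: kerv g)%VS.
  by apply: contra fu; rewrite memv_cap => /andP[/(axis_app0 fW) -> _].
have dd := dim_add_line uW.
have dk : \dim ((W :&: kerv g) + <[u]>)%VS = k.
  apply/eqP; rewrite eqn_leq (k_max (And3 g0 rt erefl)) dd.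
  by rewrite -[X in (X <= _)%N]dW leq_dim_capker.
split; last by split.
apply: NNPP => no; suff WD : (W :&: kerv g = W)%VS.
  by move: dd; rewrite dk WD dW => /esym /eqP; rewrite (gtn_eqF (ltnSn k)).
apply/capv_idPl/subvP=> x xW; rewrite mem_kerv; apply/negPn/negP=> gx.
by apply: no; exists x.
Qed.

(** Take a root (x, t) with f(x) nonzero. Some combination g - c f kills [x]; if it were nonzero it
    would also have axis [W], which would then absorb [x], although [f] vanishes on [W]. *)
Lemma axis_colinear f g W : axis k f W -> axis k g W -> exists c, g = c *: f.
Proof.
move=> fW gW; have [f0 Wf dW] := fW; have [_ Wg _] := gW.
have [x [t [xt t0 fx]]] := root_span f0.
have [[w wW tw] _] := axis_move fW xt t0 fx.
pose c := app g x / app f x; exists c.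
apply/eqP; rewrite -subr_eq0; apply/negPn/negP=> h0.
have hW : axis k (g - c *: f) W.
  split=> // y yW; apply: root_Dr; first exact: Wg.
  by rewrite -scaleNr; apply: root_Zr; apply: Wf.
have hx : app (g - c *: f) x = 0 by rewrite !appE /c divfK // subrr.
by move: fx; rewrite (axis_app0 fW) ?eqxx //; apply: axis_absorb hW xt hx wW tw.
Qed.

(** * The pencil spanned by two forms of maximal root dimension *)

Section Pencil.
Variables (f g : 'rV[K]_n) (u : 'cV[K]_n) (W : {vspace 'cV[K]_n}).
Hypotheses (fW : axis k f W) (ug : root u g) (g0 : g != 0) (fu : app f u != 0).

(** [D] has dimension k - 1 and consists of root vectors of both forms; [P] has dimension k + 1 and
    turns out to be the whole space in [pencil_full]. *)
Let D := (W :&: kerv g)%VS.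
Let P := (W + <[u]>)%VS.

Let gD : axis k g (D + <[u]>)%VS.
Proof. by case: (axis_move fW ug g0 fu). Qed.

Let pencil_w : exists2 w, w \in W & app g w != 0.
Proof. by case: (axis_move fW ug g0 fu). Qed.

Let rootDf x : x \in D -> root x f.
Proof. by rewrite memv_cap => /andP[xW _]; case: fW => _ + _; apply. Qed.

Let rootDg x : x \in D -> root x g.
Proof.
move=> xD; case: gD => _ + _; apply; apply/mem_add_line.
by exists x => //; exists 0; rewrite scale0r addr0.
Qed.

Let dimD : (\dim D).+1 = k.
Proof.
rewrite -(@dim_add_line _ _ D u); first by case: gD.
by apply: contra fu => /rootDf[-> _].
Qed.

Let D_P : (D <= P)%VS.
Proof. exact: subv_trans (capvSl _ _) (addvSl _ _). Qed.

Let gu : app g u = 0. Proof. by case: ug. Qed.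

Lemma pencil_free a b : a *: f + b *: g = 0 -> a = 0 /\ b = 0.
Proof.
have [w wW gw] := pencil_w; move=> h.
have := congr1 (fun r => app r w) h; have := congr1 (fun r => app r u) h.
rewrite /= !appE gu (axis_app0 fW wW) !mulr0 addr0 add0r.
by move=> /eqP + /eqP; rewrite !mulf_eq0 (negbTE fu) (negbTE gw) !orbF => /eqP + /eqP.
Qed.

(** Conjugating (w, f), with g(w) nonzero, by multiples of the root (u, g) reaches all the forms
    with a nonzero, up to scale; the conjugate of [w] stays in [P] and completes [D] to an axis. *)
Lemma pencil_axis a b : a *: f + b *: g != 0 ->
  exists W', [/\ axis k (a *: f + b *: g) W', (W' <= P)%VS & (D <= W')%VS].
Proof.
move=> h0; have [a0|a0] := eqVneq a 0.
  move: h0; rewrite a0 scale0r add0r scaler_eq0 negb_or => /andP[b0 _].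
  exists (D + <[u]>)%VS; split; [exact: axis_Z | exact/addvS/subvv/capvSl|].
  exact: addvSl.
have [w wW gw] := pencil_w.
(* The solution of f - l f(u) g = f + (b / a) g, the left side being the conjugated form. *)
pose l := - (b / a) / app f u.
pose w' := w + app g w *: (l *: u).
have w'h : root w' (a *: f + b *: g).
  have -> : a *: f + b *: g = a *: (f - app f (l *: u) *: g).
    rewrite appZr /l divfK // scaleNr opprK scalerDr scalerA.
    by rewrite mulrCA divff // mulr1.
  apply: root_Zr; apply: root_conj; last exact: root_Zl.
  by case: fW => _ + _; apply.
have w'D : w' \notin D.
  rewrite memv_cap mem_kerv /w' !appE gu !mulr0 addr0.
  by rewrite (negbTE gw) andbF.
exists (D + <[w']>)%VS; split; last exact: addvSl.
  split=> //; last by rewrite dim_add_line // dimD.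
  move=> x /mem_add_line[y yD [c ->]]; apply: root_Dl; last exact: root_Zl.
  by apply: root_Dr; apply: root_Zr; [apply: rootDf | apply: rootDg].
apply/subvP=> x /mem_add_line[y yD [c ->]].
apply: memvD; [exact: (subvP D_P) | apply: memvZ].
rewrite /P; apply/mem_add_line; exists w => //; exists (app g w * l).
by rewrite /w' scalerA.
Qed.

Lemma pencil_kill y : exists a b,
  a *: f + b *: g != 0 /\ app (a *: f + b *: g) y = 0.
Proof.
have [fy|fy] := eqVneq (app f y) 0.
  exists 1, 0; rewrite scale1r scale0r addr0; split=> //.
  by case: fW.
exists (- (app g y / app f y)), 1; split.
  by apply/eqP=> /pencil_free[_ /eqP]; rewrite oner_eq0.
by rewrite !appE mulNr divfK // mul1r addNr.
Qed.

(* Otherwise h is a third form, independent of f and g, whose axis contains D.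
   A root (z, t) with t nonzero on D and z outside D would make D + <z> the axis
   of two independent forms, against [axis_colinear]; so D would be invariant. *)
Lemma pencil_invariant y h : root y h -> h != 0 -> y \notin P ->
  forall x, x \in P -> app h x = 0.
Proof.
move=> yh h0 yP x xP; apply/eqP/negPn/negP=> hx.
have DW : D != 0%VS.
  by rewrite -dimv_eq0 -lt0n -ltnS dimD.
(* Some nonzero form of the pencil kills [y]. Were [h] nonzero on [D], which lies in the axis of
   that form, this axis would absorb [y], although [y] is outside [P]. *)
have hD z : z \in D -> app h z = 0.
  have [a [b [e0 ey]]] := pencil_kill y.
  have [W0 [W0a W0P DW0]] := pencil_axis e0.
  move=> zD; apply/eqP/negPn/negP=> hz.
  case/negP: yP; apply: (subvP W0P).
  by apply: axis_absorb W0a yh ey _ hz; apply: (subvP DW0).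
have step (e : 'rV[K]_n) W1 x1 : axis k e W1 -> (W1 <= P)%VS -> (D <= W1)%VS ->
    x1 \in W1 -> app h x1 != 0 ->
    axis k h ((W1 :&: kerv h) + <[y]>)%VS.
  move=> eW1 W1P DW1 x1W hx1; apply: proj2 (axis_move eW1 yh h0 _).
  apply/eqP=> ey; case/negP: yP; apply: (subvP W1P).
  exact: axis_absorb eW1 yh ey x1W hx1.
(* As [x] is a vector of [W] plus a multiple of [u], [h] is nonzero on the axis of [f] or on that of
   [g]. [step] turns that axis into one of [h], and [D] survives because [h] kills it. *)
have [W2 [W2h DW2]] : exists W2, axis k h W2 /\ (D <= W2)%VS.
  have aux (W1 : {vspace 'cV[K]_n}) : (D <= W1)%VS ->
      (D <= (W1 :&: kerv h) + <[y]>)%VS.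
    move=> DW1; apply: subv_trans (addvSl _ _); rewrite subv_cap DW1.
    by apply/subvP=> z /hD hz; rewrite mem_kerv hz.
  case/mem_add_line: xP hx => w' w'W [c ->]; rewrite !appE.
  have [hw|hw _] := eqVneq (app h w') 0.
    rewrite hw add0r mulf_eq0 negb_or => /andP[_ hu].
    exists (((D + <[u]>) :&: kerv h) + <[y]>)%VS; split; last exact/aux/addvSl.
    apply: (@step g _ u) => //; [exact/addvS/subvv/capvSl|exact: addvSl|].
    exact/(subvP (addvSr _ _))/memv_line.
  exists ((W :&: kerv h) + <[y]>)%VS; split; last exact/aux/capvSl.
  apply: (@step f _ w') => //; [exact: addvSl|exact: capvSl].
(* A form of the pencil has its axis inside [P], but [y] is a root vector of [h] outside [P]. *)
have h_out a b : h <> a *: f + b *: g.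
  move=> hE; have [W' [W'a W'P _]] : exists W', [/\ axis k h W', (W' <= P)%VS
      & (D <= W')%VS].
    by rewrite hE; apply: pencil_axis; rewrite -hE.
  by case/negP: yP; apply: (subvP W'P); apply: axis_mem W'a yh.
have rootDh z : z \in D -> root z h.
  by move=> zD; case: W2h => _ + _; apply; apply: (subvP DW2).
have Dinv z t : root z t -> z \in D \/ forall v, v \in D -> app t v = 0.
  move=> zt; have [zD|zD] := boolP (z \in D); [by left | right=> v vD].
  apply/eqP/negPn/negP=> tv.
  have C (e : 'rV[K]_n) : e != 0 -> (forall x, x \in D -> root x e) -> app e z = 0 ->
      axis k e (D + <[z]>)%VS.
    move=> e0 De ez; split=> //; last by rewrite dim_add_line // dimD.
    move=> r /mem_add_line[s sD [c ->]]; apply: root_Dl; first exact: De.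
    by apply: root_Zl; apply: root_oneway (De v vD) zt tv ez.
  (* Two nonzero combinations vanishing at [z] share the axis D + <z>, so they are proportional. *)
  have CC a b c p q r : a *: f + b *: g + c *: h != 0 ->
      p *: f + q *: g + r *: h != 0 ->
      app (a *: f + b *: g + c *: h) z = 0 ->
      app (p *: f + q *: g + r *: h) z = 0 ->
      exists l, p *: f + q *: g + r *: h = l *: (a *: f + b *: g + c *: h).
    have rt a' b' c' v' : v' \in D -> root v' (a' *: f + b' *: g + c' *: h).
      by move=> vD'; do !apply: root_Dr; apply: root_Zr; auto.
    by move=> e1 e2 z1 z2; apply: (@axis_colinear _ _ (D + <[z]>)%VS); apply: C; auto.
  have indep a b c : a *: f + b *: g + c *: h = 0 -> [/\ a = 0, b = 0 & c = 0].
    have [->|c0] := eqVneq c 0.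
      by rewrite scale0r addr0 => /pencil_free[-> ->].
    move=> e; case: (@h_out (- (a / c)) (- (b / c))).
    apply: (scalerI c0); rewrite !scalerDr !scalerA !mulrN !(mulrCA c) divff //.
    by rewrite !mulr1 !scaleNr -opprD; apply/eqP; rewrite -addr_eq0 addrC e.
  have indep' a b c p q r : app (a *: f + b *: g + c *: h) z = 0 ->
      app (p *: f + q *: g + r *: h) z = 0 ->
      (a != 0) || (b != 0) || (c != 0) -> 
      (p != 0) || (q != 0) || (r != 0) -> 
      exists l, [/\ p = l * a, q = l * b & r = l * c].
    move=> z1 z2 n1 n2.
    have nz a' b' c' : (a' != 0) || (b' != 0) || (c' != 0) ->
        a' *: f + b' *: g + c' *: h != 0.
      by apply: contraTneq => /indep[-> -> ->]; rewrite !eqxx.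
    have [l lE] := CC _ _ _ _ _ _ (nz _ _ _ n1) (nz _ _ _ n2) z1 z2.
    exists l; have /indep[/eqP + /eqP + /eqP] :
        (p - l * a) *: f + (q - l * b) *: g + (r - l * c) *: h = 0.
      move/eqP: lE; rewrite -subr_eq0 => /eqP <-; apply/rowP=> i.
      by rewrite !mxE; ring.
    by rewrite !subr_eq0 => /eqP-> /eqP-> /eqP->.
  (* Vanishing at [z] is a single condition on the three-dimensional span of [f], [g], [h]; each
     case exhibits two independent combinations satisfying it. *)
  have [fz|fz] := eqVneq (app f z) 0; last first.
    have [||||l [_ + /eqP]] := @indep' (- (app g z / app f z)) 1 0
        (- (app h z / app f z)) 0 1.
    - by rewrite !appE; field.
    - by rewrite !appE; field.
    - by rewrite oner_eq0 orbT.
    - by rewrite oner_eq0 !orbT.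
    by rewrite mulr0 oner_eq0.
  have [gz|gz] := eqVneq (app g z) 0; last first.
    have [||||l [_ + /eqP]] := @indep' 1 (- (app f z / app g z)) 0
        0 (- (app h z / app g z)) 1.
    - by rewrite !appE; field.
    - by rewrite !appE; field.
    - by rewrite oner_eq0.
    - by rewrite oner_eq0 !orbT.
    by rewrite mulr0 oner_eq0.
  have [||||l [+ /eqP]] := @indep' 1 0 0 0 1 0.
  - by rewrite !appE fz gz; ring.
  - by rewrite !appE fz gz; ring.
  - by rewrite oner_eq0.
  - by rewrite oner_eq0 !orbT.
  by rewrite mulr0 oner_eq0.
have [f0 _ _] := fW; have [v fv] := app_neq0_r f0.
by case/negP: fv; case: (rootDf (root_irr DW Dinv v)) => ->.
Qed.

(** By [pencil_invariant] the space [P] is stable under all roots, so irreducibility makes it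
    everything. Writing x = w + c u, f(x) = 0 forces c = 0. *)
Lemma pencil_full x : app f x = 0 -> root x f.
Proof.
have P0 : P != 0%VS.
  rewrite -dimv_eq0 dim_add_line //.
  by apply: contra fu => /(axis_app0 fW) ->.
have : x \in P.
  apply: root_irr => // d h dh; have [dP|dP] := boolP (d \in P); first by left.
  right=> v vP; have [->|h0] := eqVneq h 0; first by rewrite app0l.
  exact: pencil_invariant dh h0 dP v vP.
case/mem_add_line=> w wW [c ->]; rewrite !appE (axis_app0 fW wW) add0r.
move/eqP; rewrite mulf_eq0 (negbTE fu) orbF => /eqP->.
by rewrite scale0r addr0; case: fW => _ + _; apply.
Qed.

End Pencil.
End Maximal.

Lemma exists_full_form d1 f1 d2 f2 : root d1 f1 -> root d2 f2 ->
  app f2 d1 != 0 -> app f1 d2 = 0 -> d2 != 0 -> f1 != 0 ->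
  exists2 f, f != 0 & forall x, app f x = 0 -> root x f.
Proof.
move=> r1 r2 n0 e0 d20 f10; have r21 := root_oneway r1 r2 n0 e0.
(* The maximum runs over all forms at once. It is at least 2 because [d1] and [d2] span a plane of
   root vectors of [f1]: [f2] kills [d2] but not [d1]. *)
have [||k [k1 [f [W fW]] kmax]] := @ex_max_nat
    (fun k => exists f W, axis k f W) n _ 2.
- move=> k [f [W [_ _ <-]]]; apply: leq_trans (dimvS (subvf _)) _.
  by rewrite dimvf /dim /= muln1.
- exists f1, (<[d2]> + <[d1]>)%VS; split=> //.
    move=> x /mem_add_line[y /vlineP[b ->] [c ->]].
    by apply: root_Dl; apply: root_Zl.
  rewrite dim_add_line ?dim_vline ?d20 //.
  by apply: contra n0 => /vlineP[c ->]; case: r2 => h _; rewrite appE h mulr0.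
have km j f' W' : axis j f' W' -> (j <= k)%N.
  by move=> h; apply: kmax; exists f', W'.
have [f0 _ _] := fW; have [u [g [ug g0 fu]]] := root_span f0.
by exists f => // x; apply: (pencil_full k1 km fW ug g0 fu).
Qed.

End FullForms.

(** * SL_n is generated by transvections *)

Lemma ord_gtF n (i k : 'I_n) : (i < k)%N -> (k == i) = false.
Proof. by move=> ik; rewrite -val_eqE /= gtn_eqF. Qed.

Lemma ord_ltF n (i k : 'I_n) : (i < k)%N -> (i == k) = false.
Proof. by rewrite eq_sym; apply: ord_gtF. Qed.

Section ColumnReduction.
Variables (K : fieldType) (n : nat) (A : 'M[K]_n -> Prop).
Hypothesis all_tv : forall d f, app f d = 0 -> gen A (tv d f).

Local Notation ev i := (delta_mx i 0 : 'cV[K]_n).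
Local Notation fv i := (delta_mx 0 i : 'rV[K]_n).

Lemma app_delta (i j : 'I_n) : app (fv i) (ev j) = (i == j)%:R.
Proof. by rewrite app_delta_l mxE eqxx andbT. Qed.

(** If x_k = 1, one transvection sends [x] to e_k. Otherwise a nonzero entry below position k is
    used to make x_k equal to 1; if only x_k is known to be nonzero, it first makes the next entry
    1. The last position has no next entry, hence the second hypothesis. All forms used are
    coordinates of index at least k, so earlier basis vectors stay fixed. *)
Lemma move_column (k : 'I_n) (x : 'cV[K]_n) :
  (exists2 j : 'I_n, (k <= j)%N & x j 0 != 0) -> ((n.-1 <= k)%N -> x k 0 = 1) ->
  exists g, [/\ gen A g, \det g = 1, g *m x = ev k &
    forall i : 'I_n, (i < k)%N -> g *m ev i = ev i].
Proof.
have step0 (y : 'cV[K]_n) : y k 0 = 1 -> exists g, [/\ gen A g, \det g = 1, g *m y = ev k &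
    forall i : 'I_n, (i < k)%N -> g *m ev i = ev i].
  move=> yk; have z : app (fv k) (ev k - y) = 0.
    by rewrite !appE app_delta app_delta_l eqxx yk subrr.
  exists (tv (ev k - y) (fv k)); split; [exact: all_tv|exact: det_tv| |].
    by rewrite tv_mulE app_delta_l yk scale1r addrC subrK.
  move=> i ik; rewrite tv_mulE app_delta.
  by rewrite (_ : (k == i) = false) ?scale0r ?addr0 // ord_gtF.
have step1 (y : 'cV[K]_n) (j : 'I_n) : (k < j)%N -> y j 0 != 0 ->
    exists g, [/\ gen A g, \det g = 1, g *m y = ev k &
    forall i : 'I_n, (i < k)%N -> g *m ev i = ev i].
  move=> kj yj; pose c := (1 - y k 0) / y j 0.
  have jk : (j == k) = false by rewrite ord_gtF.
  have z : app (fv j) (c *: ev k) = 0 by rewrite !appE app_delta jk mulr0.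
  have [|g [Gg dg gy ge]] := step0 (tv (c *: ev k) (fv j) *m y).
    by rewrite tv_mulE !mxE app_delta_l !eqxx mulr1 /c mulrC divfK // addrC subrK.
  exists (g *m tv (c *: ev k) (fv j)); split.
  - by apply: gen_mul => //; apply: all_tv.
  - by rewrite det_mulmx dg det_tv // mulr1.
  - by rewrite -mulmxA.
  move=> i ik; rewrite -mulmxA tv_mulE app_delta.
  by rewrite (_ : (j == i) = false) ?scale0r ?addr0 ?ge // ord_gtF // (ltn_trans ik).
case=> j kj xj xk; have [kn|kn] := leqP n.-1 k; first exact/step0/xk.
move: kj; rewrite leq_eqVlt => /orP[/eqP/val_inj jk|kj]; last exact: step1 kj xj.
have k1n : (k.+1 < n)%N by rewrite -ltn_predRL.
pose j' := Ordinal k1n.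
have kj' : (k == j') = false by rewrite ord_ltF // /= ltnSn.
have z : app (fv k) ((1 - x j' 0) / x k 0 *: ev j') = 0.
  by rewrite !appE app_delta kj' mulr0.
have [||g [Gg dg gy ge]] :=
    step1 (tv ((1 - x j' 0) / x k 0 *: ev j') (fv k) *m x) j'.
- by rewrite /= ltnSn.
- rewrite tv_mulE !mxE app_delta_l !eqxx mulr1 mulrC divfK ?jk //.
  by rewrite addrC subrK oner_eq0.
exists (g *m tv ((1 - x j' 0) / x k 0 *: ev j') (fv k)); split.
- by apply: gen_mul => //; apply: all_tv.
- by rewrite det_mulmx dg det_tv // mulr1.
- by rewrite -mulmxA.
move=> i ik; rewrite -mulmxA tv_mulE app_delta.
by rewrite (_ : (k == i) = false) ?scale0r ?addr0 ?ge // ord_gtF.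
Qed.

(** Induction on the number [q] of columns not yet known to be standard, clearing them from left to
    right. *)
Lemma gen_of_det1 (m : 'M[K]_n) : \det m = 1 -> gen A m.
Proof.
suff H q : forall m : 'M[K]_n, \det m = 1 ->
    (forall i : 'I_n, (i < n - q)%N -> m *m ev i = ev i) -> gen A m.
  by move=> dm; apply: (H n) => // i; rewrite subnn.
elim: q => [|q IH] {}m dm mE.
  suff -> : m = 1%:M by apply: gen_one.
  apply/matrixP=> i j; have := congr1 (fun M : 'cV_n => M i 0) (mE j _).
  rewrite subn0 -colE !mxE eqxx andbT eq_sym => -> //; by rewrite eq_sym.
have [nq|qn] := leqP n q.
  by apply: IH => // i; rewrite (eqP (nq : (n - q == 0)%N)).
have kn : (n - q.+1 < n)%N by rewrite -subn_gt0 subKn.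
pose k := Ordinal kn.
have um : m \in unitmx by rewrite unitmxE dm unitr1.
have [x xE] : exists x, x = m *m ev k by exists (m *m ev k).
have [||g [Gg dg gx ge]] := @move_column k x.
- apply: NNPP => no.
  have x0 (j : 'I_n) : (k <= j)%N -> x j 0 = 0.
    by move=> kj; apply/eqP/negPn/negP=> xj; apply: no; exists j.
  (* If column k had no entry at or below the diagonal, it would combine the earlier standard
     columns; [y] is this relation, killed by the invertible [m] although y_k = 1. *)
  pose y := ev k - \sum_(i < n | (i < k)%N) x i 0 *: ev i.
  have my : m *m y = 0.
    rewrite /y mulmxBr mulmx_sumr -xE (eq_bigr (fun i => x i 0 *: ev i)).
      apply/eqP; rewrite subr_eq0; apply/eqP/colP=> j; rewrite summxE.
      have [jk|kj] := ltnP j k; last first.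
        rewrite x0 // big1 // => i ik; rewrite !mxE eqxx andbT.
        by rewrite ord_gtF ?mulr0 //; apply: leq_trans ik kj.
      rewrite (bigD1 j) //= big1 ?addr0 => [|i /andP[_ ij]]; rewrite !mxE eqxx andbT.
        by rewrite ?eqxx mulr1.
      by rewrite eq_sym (negbTE ij) mulr0.
    by move=> i ik; rewrite -scalemxAr mE.
  have : y k 0 = 0.
    by rewrite -[y](mulKmx um) my mulmx0 mxE.
  rewrite !mxE summxE big1 => [|i ik].
    by rewrite !eqxx subr0 => /eqP; rewrite oner_eq0.
  by rewrite !mxE eqxx andbT ord_gtF ?mulr0.
- move=> nk; have kE : k = n.-1 :> nat.
    by apply/eqP; rewrite eqn_leq nk andbT -ltnS (ltn_predK kn).
  have mij (i j : 'I_n) : (j < k)%N -> m i j = (i == j)%:R.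
    move=> jk; have := congr1 (fun M : 'cV_n => M i 0) (mE j jk).
    by rewrite -colE !mxE eqxx andbT.
  (* Only the last column is left, so [m] is upper triangular and its determinant is its last
     diagonal entry. *)
  have tm : is_trig_mx m^T.
    apply/is_trig_mxP=> i j ij; rewrite mxE mij.
      by rewrite ord_gtF.
    by apply: leq_trans ij _; rewrite kE -ltnS (ltn_predK kn).
  have := det_trig tm; rewrite det_tr dm (bigD1 k) //= big1 => [|i ik].
    by rewrite mulr1 xE -colE !mxE => <-.
  rewrite mxE mij ?eqxx // ltn_neqAle; apply/andP; split; first exact: ik.
  by rewrite kE -ltnS (ltn_predK kn).
have [ug gi] : g \in unitmx /\ gen A (invmx g).
  by split; [rewrite unitmxE dg unitr1 | apply: gen_inv].
rewrite -[m](mulKmx ug); apply: gen_mul => //; apply: IH.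
  by rewrite det_mulmx dg dm mulr1.
move=> i iq; rewrite -mulmxA.
have [ik|ki] := ltnP i k; first by rewrite mE // ge.
have -> : i = k; last by rewrite -xE gx.
by apply/val_inj/eqP; rewrite eqn_leq ki andbT /= -ltnS -subSn // subSS.
Qed.

End ColumnReduction.

(** * Generation from a one-way edge *)

Section Generation.
Variables (K : fieldType) (n : nat) (S : 'M[K]_n -> Prop).
Hypothesis HS : forall t, S t -> is_transvection t.
Implicit Types (d e x : 'cV[K]_n) (f g : 'rV[K]_n).
Local Notation root := (transv_root (SK S)).

Lemma transvectionP d f : is_transvection (tv d f) ->
  [/\ d != 0, f != 0 & app f d = 0].
Proof.
case=> d' [f' [d0 f0 fd /(tv_inj d0 f0)[c [c0 -> ->]]]].
by rewrite !scaler_eq0 !negb_or invr_eq0 c0 d0 f0 !appE fd !mulr0.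
Qed.

Lemma root_of_mem d f : S (tv d f) -> root d f.
Proof.
move=> St; have [_ _ fd] := transvectionP (HS St).
by split=> // l; apply: gen_in; exists d, f, l.
Qed.

Lemma det_gen m : gen (SK S) m -> \det m = 1.
Proof.
elim=> [|t [d [f [l [St ->]]]]|a b _ da _ db|a _ da].
- by rewrite det1.
- have [_ _ fd] := transvectionP (HS St).
  by rewrite det_tv // appE fd mulr0.
- by rewrite det_mulmx da db mulr1.
by rewrite det_inv da invr1.
Qed.

Hypotheses (p1 : P1 S) (p2 : P2 S).

Lemma form_meets_S f : f != 0 -> exists d g, S (tv d g) /\ app f d != 0.
Proof.
case/app_neq0_r=> x fx; apply: NNPP => no.
have [m [c [d [g [Sdg xE]]]]] := p1.1 x.
case/eqP: fx; rewrite xE app_sumr big1 // => i _; rewrite appE.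
apply/eqP; rewrite mulf_eq0; apply/orP; right; apply/negPn/negP=> h.
by apply: no; exists (d i), (g i).
Qed.

Lemma vector_meets_S x : x != 0 -> exists d g, S (tv d g) /\ app g x != 0.
Proof.
case/app_neq0_l=> f fx; apply: NNPP => no.
have [m [c [d [g [Sdg fE]]]]] := p1.2 f.
case/eqP: fx; rewrite fE app_suml big1 // => i _; rewrite appE.
apply/eqP; rewrite mulf_eq0; apply/orP; right; apply/negPn/negP=> h.
by apply: no; exists (d i), (g i).
Qed.

Lemma vertexP d f : S (tv d f) -> vertex S (tv d f).
Proof.
move=> St; split=> // /eqP; rewrite -subr_eq0 /tv addrC addKr => /eqP h.
have [d0 f0 _] := transvectionP (HS St); have [x fx] := app_neq0_r f0.
have : d *m f *m x = 0 by rewrite h mul0mx.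
rewrite -mulmxA mul_app mul_mx_scalar => /eqP.
by rewrite scaler_eq0 (negbTE d0) (negbTE fx).
Qed.

Lemma connected d f d' f' : S (tv d f) -> S (tv d' f') ->
  clos_refl_trans _ (gedge S) (tv d f) (tv d' f').
Proof. by move=> /vertexP h /vertexP h'; apply: p2. Qed.

(** Some form of [S] is nonzero on [U], so its vector lies in [U]. An edge from (d1, f1) to (d2, f2)
    with d1 in U forces d2 in U, so strong connectivity puts all vectors of [S] in [U], and they
    span. *)
Lemma roots_irreducible (U : {vspace 'cV[K]_n}) : U != 0%VS ->
  (forall d f, root d f -> d \in U \/ forall u, u \in U -> app f u = 0) ->
  forall x, x \in U.
Proof.
move=> U0 inv; have u0 : vpick U != 0 by rewrite vpick0.
have [d0 [g0 [S0 gu]]] := vector_meets_S u0.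
have d0U : d0 \in U.
  case: (inv _ _ (root_of_mem S0)) => // /(_ _ (memv_pick U)) h.
  by rewrite h eqxx in gu.
(* Vertices are matrices, so the property is required of every factorisation; [tv_inj] passes
   between them. *)
pose Q t := forall d f, t = tv d f -> S t -> d \in U.
have walk r s : clos_refl_trans _ (gedge S) r s -> Q r -> Q s.
  elim=> [a b [[Sa _] [Sb _] [d1 [f1 [d2 [f2 [aE bE n0]]]]]]||] //; last by auto.
  move=> Qa d f bE' _.
  have d1U : d1 \in U by apply: (Qa _ f1).
  rewrite bE in Sb; have [d20 f20 _] := transvectionP (HS Sb).
  rewrite bE in bE'; have [c [c0 -> _]] := tv_inj d20 f20 (esym bE').
  apply: memvZ; case: (inv _ _ (root_of_mem Sb)) => // /(_ _ d1U) h.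
  by rewrite h eqxx in n0.
have SU d f : S (tv d f) -> d \in U.
  move=> St; apply: (walk _ _ (connected S0 St)) erefl St.
  move=> d1 f1 E _; have [d00 g00 _] := transvectionP (HS S0).
  by have [c [c0 -> _]] := tv_inj d00 g00 (esym E); apply: memvZ.
move=> x; have [m [c [d [g [Sdg ->]]]]] := p1.1 x.
by apply: memv_suml => i _; apply: memvZ; apply: SU (Sdg i).
Qed.

Definition full_form f := forall x, app f x = 0 -> root x f.

(** Fullness travels against edges. Split x in ker g as (x - c u) + c u with x - c u in ker f; the
    edge from (u, g) to the root (x - c u, f) is one-way. *)
Lemma full_form_pred f u g : full_form f -> root u g -> app f u != 0 ->
  full_form g.
Proof.
move=> ff ug fu x gx; pose c := app f x / app f u.
have -> : x = (x - c *: u) + c *: u by rewrite subrK.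
apply: root_Dl; last exact: root_Zl.
apply: (root_oneway ug _ fu).
  by apply: ff; rewrite !appE /c divfK // subrr.
by case: ug => gu _; rewrite !appE gx gu; ring.
Qed.

Lemma full_form_Z c f : full_form f -> full_form (c *: f).
Proof.
move=> ff x; have [->|c0] := eqVneq c 0.
  by rewrite scale0r => _; split=> [|l]; rewrite ?app0l // -[0](scale0r 0)
    -tvZ scale0r tv0; apply: gen_one.
rewrite appE => /eqP; rewrite mulf_eq0 (negbTE c0) /= => /eqP h.
by apply: root_Zr; apply: ff.
Qed.

(** In the independent case pick [w] in ker f with g(w) = 1 and [u] in ker g with f(u) = 1. The
    kernel of f + g is spanned by u - w and the common kernel of [f] and [g], and conjugating (w, f)
    by (-u, g) yields the root (w - u, f + g). *)
Lemma full_form_D f g : full_form f -> full_form g -> full_form (f + g).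
Proof.
move=> ff fg.
have [[c ->]|nc] := classic (exists c, g = c *: f).
  by rewrite -[X in X + _]scale1r -scalerDl; apply: full_form_Z.
have [[c ->]|nc'] := classic (exists c, f = c *: g).
  by rewrite -[X in _ + X]scale1r -scalerDl; apply: full_form_Z.
have ker_out (h k : 'rV[K]_n) : ~ (exists c, k = c *: h) -> exists2 w, app h w = 0 & app k w = 1.
  move=> no; apply: NNPP => no'; apply: no; apply: sub_ker_colinear => d hd.
  apply/eqP/negPn/negP=> kd; apply: no'; exists ((app k d)^-1 *: d).
    by rewrite appE hd mulr0.
  by rewrite appE mulVf.
have [w fw gw] := ker_out _ _ nc; have [u gu fu] := ker_out _ _ nc'.
move=> x; rewrite appE => fgx; pose c := app f x.
have gx : app g x = - c by apply/eqP; rewrite -addr_eq0 addrC fgx.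
have -> : x = (x - c *: (u - w)) + c *: (u - w) by rewrite subrK.
apply: root_Dl.
  apply: root_Dr; [apply: ff | apply: fg]; rewrite !appE ?gx ?gu ?gw ?fu ?fw /c; ring.
apply: root_Zl.
have := root_conj (ff w fw) (root_Zl (-1) (fg u gu)).
rewrite gw scale1r appE fu mulr1 !scaleN1r opprK => /(root_Zl (-1)).
by rewrite scaleN1r opprB.
Qed.

Lemma generates_of_oneway d1 f1 d2 f2 : root d1 f1 -> root d2 f2 ->
  app f2 d1 != 0 -> app f1 d2 = 0 -> d2 != 0 -> f1 != 0 ->
  generates_SL (SK S).
Proof.
move=> r1 r2 n0 e0 d20 f10.
have span f : f != 0 -> exists d g, [/\ root d g, g != 0 & app f d != 0].
  move=> /form_meets_S[d [g [St fd]]]; exists d, g.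
  by have [_ g0 _] := transvectionP (HS St); split=> //; apply: root_of_mem.
have [f ff full] := exists_full_form roots_irreducible span r1 r2 n0 e0 d20 f10.
have [d0 [g0 [S0 fd0]]] := form_meets_S ff.
have full0 := full_form_pred full (root_of_mem S0) fd0.
pose Q t := forall d f, t = tv d f -> S t -> full_form f.
(* The walk is followed backwards, ending at the vertex whose form [g0] is full. *)
have walk r s : clos_refl_trans _ (gedge S) r s -> Q s -> Q r.
  elim=> [a b [[Sa _] [Sb _] [d [f' [d' [g' [aE bE nz]]]]]]||] //; last by auto.
  move=> Qb d3 f3 aE' _.
  rewrite aE in Sa; have [d00 f00 _] := transvectionP (HS Sa).
  rewrite aE in aE'; have [c [c0 _ ->]] := tv_inj d00 f00 (esym aE').
  apply: full_form_Z; apply: full_form_pred (root_of_mem Sa) nz.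
  exact: Qb bE Sb.
have fullS d g : S (tv d g) -> full_form g.
  move=> St; apply: (walk _ _ (connected St S0)) erefl St.
  move=> d' f' E _; have [d00 g00 _] := transvectionP (HS S0).
  by have [c [c0 _ ->]] := tv_inj d00 g00 (esym E); apply: full_form_Z.
have all_full g : full_form g.
  have [m [c [d [h [Sdh ->]]]]] := p1.2 g.
  elim/big_ind: _ => [||i _]; [|exact: full_form_D|].
    by rewrite -(scale0r f); apply: full_form_Z.
  by apply: full_form_Z; apply: fullS (Sdh i).
move=> m; split; first exact: det_gen.
apply: gen_of_det1 => d g gd.
by case: (all_full g d gd) => _ /(_ 1); rewrite scale1r.
Qed.

End Generation.

(** * Closed walks of roots *)

Section Walks.
Variables (K : fieldType) (T : Type) (e : T -> T -> Prop) (w : T -> T -> K).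

(** The product [c] of the weights is an argument, so initial edges can be peeled off without
    reindexing; [walk_fun] and [fun_walk] translate to sequences. *)
Fixpoint walk (k : nat) (x z : T) (c : K) : Prop :=
  if k is k'.+1 then
    exists y c', [/\ e x y, walk k' y z c' & c = w x y * c']
  else x = z /\ c = 1.

Lemma walk_fun k (a : nat -> T) : (forall i, (i < k)%N -> e (a i) (a i.+1)) ->
  walk k (a 0%N) (a k) (\prod_(i < k) w (a i) (a i.+1)).
Proof.
elim: k a => [|k IH] a ea /=; first by rewrite big_ord0.
exists (a 1%N), (\prod_(i < k) w (a i.+1) (a i.+2)); split.
- exact: ea.
- by apply: (IH (fun i => a i.+1)) => i ik; apply: ea.
by rewrite big_ord_recl.
Qed.

Lemma fun_walk k x z c : walk k x z c -> exists a : nat -> T,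
  [/\ a 0%N = x, a k = z, forall i, (i < k)%N -> e (a i) (a i.+1) &
      c = \prod_(i < k) w (a i) (a i.+1)].
Proof.
elim: k x c => [|k IH] x c /=.
  by case=> <- ->; exists (fun=> x); rewrite big_ord0.
case=> y [c' [xy /IH[a [a0 ak ea ->]] ->]].
exists (fun i => if i is j.+1 then a j else x); split=> //.
  by case=> [|i] ik; [rewrite a0 | apply: ea].
by rewrite big_ord_recl a0.
Qed.

Lemma walk_cat k l x y z c d : walk k x y c -> walk l y z d ->
  walk (k + l) x z (c * d).
Proof.
elim: k x c => [|k IH] x c /=; first by case=> -> ->; rewrite mul1r.
case=> t [c' [xt tw ->]] yz; exists t, (c' * d).
by split; rewrite ?mulrA //; apply: IH.
Qed.

Hypothesis e_sym : forall x y, e x y -> e y x.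
Hypothesis w_inv : forall x y, e x y -> w x y * w y x = 1.

Lemma walk_rev k x y c : walk k x y c -> walk k y x c^-1.
Proof.
elim: k x c => [|k IH] x c /=; first by case=> -> ->; rewrite invr1.
case=> t [c' [xt /IH tw ->]].
suff : walk (k + 1) y x (c'^-1 * (w x t)^-1) by rewrite addn1 invfM mulrC.
apply: walk_cat tw _; exists x, 1; split=> //; first exact: e_sym.
rewrite mulr1; have h := w_inv xt.
have n0 : w x t != 0 by apply: contra_eq_neq h => ->; rewrite mul0r eq_sym oner_neq0.
by apply: (mulfI n0); rewrite h divff.
Qed.

End Walks.

(** * Products of ratios along closed walks when no edge of roots is one-way *)

Section SymmetricRoots.
Variables (K : fieldType) (n : nat) (A : 'M[K]_n -> Prop).
Local Notation pt := ('cV[K]_n * 'rV[K]_n)%type.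
Implicit Types (p q r s : pt).

Definition proper_root p := [/\ transv_root A p.1 p.2, p.1 != 0 & p.2 != 0].

Definition root_edge p q :=
  [/\ proper_root p, proper_root q & app q.2 p.1 != 0].

(** With this sign a skew pairing has all ratios 1, and a cycle with edges in both directions is
    non-singular exactly when its ratios do not multiply to 1. *)
Definition edge_ratio p q : K := - (app q.2 p.1 / app p.2 q.1).

(** The factors of the conjugate of [tv p.1 p.2] by [tv (l *: q.1) q.2], when q is a root. *)
Definition pt_conj l p q : pt :=
  (p.1 + app q.2 p.1 *: (l *: q.1), p.2 - app p.2 (l *: q.1) *: q.2).

Lemma pt_conj_proper l p q : proper_root p -> proper_root q ->
  proper_root (pt_conj l p q).
Proof.
case: p q => [d f] [e g] [/= rp d0 f0] [/= rq e0 g0].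
split=> /=; first exact: root_conj (root_Zl _ rq).
- apply: contra_neq d0 => h; have := congr1 (fun v => app g v) h.
  rewrite /= !appE; case: rq => -> _; rewrite !mulr0 addr0 => gd.
  by move: h; rewrite gd scale0r addr0.
- apply: contra_neq f0 => h; have := congr1 (fun v => app v e) h.
  rewrite /= !appE; case: rq => -> _; rewrite mulr0 subr0 => fe.
  by move: h; rewrite appE fe mulr0 scale0r subr0.
Qed.

Hypothesis edge_sym : forall p q, proper_root p -> proper_root q ->
  app q.2 p.1 != 0 -> app p.2 q.1 != 0.

Lemma root_edge_sym p q : root_edge p q -> root_edge q p.
Proof. by case=> hp hq h; split=> //; apply: edge_sym. Qed.

Lemma edge_ratioV p q : root_edge p q -> edge_ratio p q * edge_ratio q p = 1.
Proof.
move=> pq; have [_ _ h1] := pq; have [_ _ h2] := root_edge_sym pq.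
by rewrite /edge_ratio; field; apply/andP.
Qed.

(** The scalar [l] is chosen so that the form of [p] conjugated by [q] kills the vector of [r]. By
    symmetry the form of [r] kills the conjugated vector, and this equation is the identity of
    ratios. *)
Lemma edge_ratio_triangle p q r : root_edge p q -> root_edge q r ->
  root_edge p r -> edge_ratio p q * edge_ratio q r = edge_ratio p r.
Proof.
move=> pq qr pr; have [Hp Hq n1] := pq; have [_ Hr n2] := qr; have [_ _ n3] := pr.
have [_ _ m1] := root_edge_sym pq; have [_ _ m2] := root_edge_sym qr.
have [_ _ m3] := root_edge_sym pr.
pose l := app p.2 r.1 / (app p.2 q.1 * app q.2 r.1).
have Hp' := pt_conj_proper l Hp Hq.
have z : app (pt_conj l p q).2 r.1 = 0.
  by rewrite /= !appE /l; field; apply/andP.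
have : app r.2 (pt_conj l p q).1 = 0.
  by apply/eqP/negPn/negP=> /(edge_sym Hp' Hr); rewrite z eqxx.
rewrite /= !appE /l => h; rewrite /edge_ratio.
have -> : app r.2 p.1 = - (app q.2 p.1 *
    (app p.2 r.1 / (app p.2 q.1 * app q.2 r.1) * app r.2 q.1)).
  by apply/eqP; rewrite -addr_eq0 h.
by field; rewrite ?n1 ?n2 ?n3 ?m1 ?m2 ?m3.
Qed.

Local Notation rwalk := (walk root_edge edge_ratio).

(* Writing the walk as a, b, c, d, ..., either a-c or b-d is a chord, or the
   two middle vertices can be replaced by the conjugate of c under b. *)
Lemma walk_shorten k p z x : rwalk k.+3 p z x -> rwalk k.+2 p z x.
Proof.
case=> q [c1 [pq [r [c2 [qr [s [c3 [rs sw ->]]] ->]]] ->]].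
have [Hp Hq n1] := pq; have [_ Hr n2] := qr; have [_ Hs n3] := rs.
have [_ _ m1] := root_edge_sym pq; have [_ _ m2] := root_edge_sym qr.
have [_ _ m3] := root_edge_sym rs.
have [pr|pr] := eqVneq (app r.2 p.1) 0; last first.
  have pr' : root_edge p r by split.
  exists r, (edge_ratio r s * c3); split=> //; first by exists s, c3.
  by rewrite mulrA edge_ratio_triangle.
have [qs|qs] := eqVneq (app s.2 q.1) 0; last first.
  have qs' : root_edge q s by split.
  exists q, (edge_ratio q s * c3); split=> //; first by exists s, c3.
  by rewrite -(edge_ratio_triangle qr rs qs') !mulrA.
have rp : app p.2 r.1 = 0.
  by apply/eqP/negPn/negP=> /(edge_sym Hr Hp); rewrite pr eqxx.
have sq : app q.2 s.1 = 0.
  by apply/eqP/negPn/negP=> /(edge_sym Hs Hq); rewrite qs eqxx.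
have Hr' := pt_conj_proper 1 Hr Hq.
exists (pt_conj 1 r q), (edge_ratio (pt_conj 1 r q) s * c3); split.
- split=> //=; rewrite !appE pr mul1r sub0r oppr_eq0.
  by rewrite mulf_neq0.
- exists s, c3; split=> //; split=> //=.
  by rewrite !appE qs !mulr0 addr0.
rewrite !mulrA; congr (_ * c3); rewrite /edge_ratio /= !appE pr rp qs sq.
rewrite !mul1r !mulr0 !add0r !addr0 !subr0; by field; rewrite ?n1 ?n2 ?n3 ?m1 ?m2 ?m3.
Qed.

(** Shortening ends at length 2, where the two ratios are inverse; length 1 is impossible because
    f(d) = 0 for a root. *)
Lemma closed_walk k p c : rwalk k p p c -> c = 1.
Proof.
case: k => [|[|k]]; first by case.
  case=> q [c' [pq [qp _] _]]; move: pq; rewrite qp => -[[[pp _] _ _] _].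
  by rewrite pp eqxx.
elim: k => [|k IH]; last by move/walk_shorten/IH.
case=> q [c1 [pq [r [c2 [qr [rp ->] ->]]] ->]].
by rewrite rp mulr1 edge_ratioV.
Qed.

End SymmetricRoots.

(** * One-way edges of roots from non-singular cycles and from t-equivalences *)

Section Cycles.
Variables (K : fieldType) (n : nat) (S : 'M[K]_n -> Prop).
Hypothesis HS : forall t, S t -> is_transvection t.
Implicit Types (d e x : 'cV[K]_n) (f g : 'rV[K]_n).

Lemma edge_tv d f d' f' : is_transvection (tv d f) -> is_transvection (tv d' f') ->
  edge (tv d f) (tv d' f') -> app f' d != 0.
Proof.
move=> /transvectionP[d0 f0 _] /transvectionP[d0' f0' _].
case=> d1 [f1 [d2 [f2 [E1 E2]]]].
have [a [a0 -> _]] := tv_inj d0 f0 (esym E1).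
have [b [b0 _ ->]] := tv_inj d0' f0' (esym E2).
by rewrite !appE !mulf_eq0 !negb_or => /and3P[].
Qed.

Definition oneway_roots (A : 'M[K]_n -> Prop) := exists p q,
  [/\ proper_root A p, proper_root A q, app q.2 p.1 != 0 & app p.2 q.1 = 0].

Lemma proper_root_of_mem d f : S (tv d f) -> proper_root (SK S) (d, f).
Proof.
move=> St; have [d0 f0 _] := transvectionP (HS St).
by split=> //; apply: root_of_mem.
Qed.

Lemma oneway_of_P3 : P3 S -> oneway_roots (SK S).
Proof.
case=> k [v [f [k3 vS _ ed nz]]]; apply: NNPP => no.
have sym p q : proper_root (SK S) p -> proper_root (SK S) q ->
    app q.2 p.1 != 0 -> app p.2 q.1 != 0.
  by move=> Hp Hq h; apply/eqP=> h'; apply: no; exists p, q.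
case: k => [|k] // in v f k3 vS ed nz *.
(* The cycle is extended periodically to all naturals, so that it becomes a closed walk with
   [a k.+1 = a 0]. *)
pose a (i : nat) : 'cV[K]_n * 'rV[K]_n :=
  (v (inord (i %% k.+1)), f (inord (i %% k.+1))).
have aE (i : 'I_k.+1) : a i = (v i, f i) by rewrite /a modn_small // inord_val.
have aS (i : 'I_k.+1) : a i.+1 = (v (ordS i), f (ordS i)).
  rewrite /a; suff -> : inord (i.+1 %% k.+1) = ordS i by [].
  by apply/val_inj; rewrite /= inordK // ltn_pmod.
have Hv (i : 'I_k.+1) : proper_root (SK S) (v i, f i).
  by apply: proper_root_of_mem; case: (vS i).
have Hedge (i : 'I_k.+1) : app (f (ordS i)) (v i) != 0.
  by apply: (edge_tv _ _ (ed i)); apply: HS; case: (vS i); case: (vS (ordS i)).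
have Hedge' (i : 'I_k.+1) : app (f i) (v (ordS i)) != 0.
  exact: (sym _ _ (Hv i) (Hv (ordS i)) (Hedge i)).
have : walk (root_edge (SK S)) (@edge_ratio K n) k.+1 (a 0%N) (a k.+1)
    (\prod_(i < k.+1) edge_ratio (a i) (a i.+1)).
  apply: walk_fun => i ik; rewrite (aE (Ordinal ik)) (aS (Ordinal ik)).
  by split; [exact: Hv | exact: Hv | exact: (Hedge (Ordinal ik))].
have -> : a k.+1 = a 0%N by rewrite /a modnn mod0n.
move/(closed_walk sym) => pr.
case/eqP: nz; move: pr.
under eq_bigr => i _ do rewrite aE aS /edge_ratio /=.
rewrite prodrN card_ord big_split /= prodfV.
set X := \prod_(i < _) app (f (ordS i)) _.
have : \prod_(i < k.+1) app (f i) (v (ordS i)) != 0.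
  by apply/prodf_neq0 => i _.
set Y := \prod_(i < _) _ => Y0 h.
have -> : Y = (-1) ^+ k.+1 * X.
  by apply: (mulIf (invr_neq0 Y0)); rewrite divff // -mulrA h.
by rewrite exprS mulN1r mulNr addNr.
Qed.

(** The new element is a conjugate of one root by another, so every set in the chain still consists
    of roots of the same group, generated by [A]. *)
Lemma roots_equiv_step (S1 S2 : 'M[K]_n -> Prop) A :
  equiv_step S1 S2 ->
  (forall d f, S1 (tv d f) -> proper_root A (d, f)) ->
  (forall t, S1 t -> is_transvection t) ->
  (forall d f, S2 (tv d f) -> proper_root A (d, f)) /\
  (forall t, S2 t -> is_transvection t).
Proof.
case=> x [y [Sx [Sy TE]]] rS tS.
have [d [f [d0 f0 fd xE]]] := tS _ Sx; have [e [g [e0 g0 ge yE]]] := tS _ Sy.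
rewrite xE in Sx TE *; rewrite yE in Sy TE *.
have cE : tv e g *m tv d f *m invmx (tv e g) =
    tv (pt_conj 1 (d, f) (e, g)).1 (pt_conj 1 (d, f) (e, g)).2.
  rewrite invmx_tv // conj_tv ?tvNK // tv_mulE mul_tvE /= !appE scale1r mul1r.
  by rewrite scaleNr.
have [rc c0 c0'] := pt_conj_proper 1 (rS _ _ Sx) (rS _ _ Sy).
split=> [d' f'|t] /TE[[St _]|]; first exact: rS.
- rewrite cE => /(tv_inj c0 c0')[c [cn -> ->]].
  split=> /=; first exact/root_Zl/root_Zr.
    by rewrite scaler_eq0 negb_or cn.
  by rewrite scaler_eq0 negb_or invr_eq0 cn.
- exact: tS.
by rewrite cE => ->; exists (pt_conj 1 (d, f) (e, g)).1, (pt_conj 1 (d, f) (e, g)).2;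
  case: rc.
Qed.

Lemma oneway_of_P3' : P3' S -> oneway_roots (SK S).
Proof.
case=> S' [SS' [r [s [[[Sr r1] [Ss s1] ed] no]]]].
pose inv A T := (forall d f, T (tv d f) -> proper_root A (d, f)) /\
  (forall t : 'M[K]_n, T t -> is_transvection t).
have keep A S1 S2 : clos_refl_trans _ (@equiv_step K n) S1 S2 ->
    inv A S1 -> inv A S2.
  by elim=> [T1 T2 h [h1 h2]||T1 T2 T3 _ h1 _ h2 /h1/h2] //;
    apply: roots_equiv_step h h1 h2.
have [|rS tS] := keep (SK S) _ _ SS'.
  by split=> // d f; apply: proper_root_of_mem.
have [d [f [_ _ _ rE]]] := tS _ Sr; have [d' [f' [_ _ _ sE]]] := tS _ Ss.
rewrite rE in Sr r1 ed no *; rewrite sE in Ss s1 ed no *.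
exists (d, f), (d', f'); split; [exact: rS|exact: rS| |].
  by apply: edge_tv ed; apply: tS.
apply/eqP/negPn/negP=> h; apply: no; split=> //.
by exists d', f', d, f.
Qed.

End Cycles.

(** * Properties P1 and P2 of generating sets *)

Section Combinations.
Variables (K : fieldType) (V : lmodType K) (X : V -> Prop).

(** Phrased like [P1], over an abstract space so that it serves both columns and rows. *)
Definition combination (x : V) := exists (m : nat) (c : 'I_m -> K) (d : 'I_m -> V),
  (forall i, X (d i)) /\ x = \sum_(i < m) c i *: d i.

Lemma combination_mem c x : X x -> combination (c *: x).
Proof.
by move=> Xx; exists 1%N, (fun=> c), (fun=> x); split=> //; rewrite big_ord1.
Qed.

Lemma combination_D x y : combination x -> combination y -> combination (x + y).
Proof.
case=> m [c [d [Xd ->]]] [m' [c' [d' [Xd' ->]]]].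
exists (m + m')%N,
  (fun i => match split i with inl j => c j | inr j => c' j end),
  (fun i => match split i with inl j => d j | inr j => d' j end).
split=> [i|]; first by case: split.
rewrite big_split_ord; congr (_ + _); apply: eq_bigr => i _.
  by rewrite (unsplitK (inl i)).
by rewrite (unsplitK (inr i)).
Qed.

End Combinations.

Section Converse.
Variables (K : fieldType) (n : nat) (S : 'M[K]_n -> Prop).
Hypotheses (n3 : (3 <= n)%N) (HS : forall t, S t -> is_transvection t).
Implicit Types (d e x y z : 'cV[K]_n) (f g : 'rV[K]_n).

Lemma exists_form_ker2 x y : exists2 f, f != 0 & app f x = 0 /\ app f y = 0.
Proof.
have : kermx (row_mx x y) != 0.
  rewrite -mxrank_eq0 mxrank_ker -lt0n subn_gt0.
  by apply: leq_ltn_trans (rank_leq_col _) n3.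
case/rowV0Pn=> f /sub_kermxP; rewrite mul_mx_row => h f0; exists f => //.
have := congr1 lsubmx h; have := congr1 rsubmx h.
rewrite row_mxKl row_mxKr /app => -> ->.
by rewrite !mxE.
Qed.

Lemma exists_vector_ker f : exists2 d, d != 0 & app f d = 0.
Proof.
have [g g0 [h _]] := exists_form_ker2 f^T f^T.
exists g^T; first by rewrite trmx_eq0.
by rewrite /app -[f]trmxK -trmx_mul mxE.
Qed.

(** No inverse case is needed because [SK S] is closed under inverses: the property is carried for
    [m] and its inverse together. *)
Lemma gen_SK_ind (Q : 'M[K]_n -> Prop) : Q 1%:M ->
  (forall d f l, S (tv d f) -> Q (tv (l *: d) f)) ->
  (forall a b, Q a -> Q b -> Q (a *m b)) ->
  forall m, gen (SK S) m -> Q m.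
Proof.
move=> Q1 Qt QM m gm.
suff [] : [/\ Q m, Q (invmx m) & m \in unitmx] by [].
elim: gm => [|t [d [f [l [St ->]]]]|a b _ [Qa Qa' ua] _ [Qb Qb' ub]|a _ [Qa Qa' ua]].
- by rewrite invmx1 unitmx1.
- have [_ _ fd] := transvectionP (HS St).
  have ld : app f (l *: d) = 0 by rewrite appE fd mulr0.
  split; [exact: Qt| |exact: tv_unit].
  by rewrite invmx_tv // -scaleNr; apply: Qt.
- split; [exact: QM| |by rewrite unitmx_mul ua].
  suff -> : invmx (a *m b) = invmx b *m invmx a by apply: QM.
  have uab : a *m b \in unitmx by rewrite unitmx_mul ua.
  rewrite -[RHS](mulKmx uab) -!mulmxA [b *m _]mulmxA mulmxV // mul1mx.
  by rewrite mulmxV // mulmx1.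
by split; rewrite ?invmxK ?unitmx_inv.
Qed.

Section Preservation.
Hypothesis gS : generates_SL (SK S).

Lemma SL_tv d f : app f d = 0 -> gen (SK S) (tv d f).
Proof. by move=> fd; apply/gS; apply: det_tv. Qed.

(** Every displacement m x - x by a group element is a combination of vectors of [S], since a b w -
    w = (a (b w) - b w) + (b w - w). A transvection with vector [x] has [x] itself as a
    displacement. The second half is the same argument on rows. *)
Lemma P1_of_SL : P1 S.
Proof.
split=> [x|y].
  suff [m [c [d [Xd ->]]]] : combination (fun d => exists f, S (tv d f)) x.
    by have [f Sf] := fin_all_exists Xd; exists m, c, d, f.
  pose Q (m : 'M[K]_n) := forall x,
    combination (fun d => exists f, S (tv d f)) (m *m x - x).
  have /gen_SK_ind H : Q 1%:M.
    by move=> z; rewrite mul1mx subrr; exists 0%N, (fun=> 0), (fun=> 0);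
      split=> [[]|]; rewrite ?big_ord0.
  have [f f0 [fx _]] := exists_form_ker2 x x; have [z fz] := app_eq1_r f0.
  have : Q (tv x f).
    apply: H (SL_tv fx) => [d g l Sd w|a b Qa Qb w].
      rewrite tv_mulE addrC addKr scalerA; apply: combination_mem; by exists g.
    rewrite -mulmxA -[_ - _](subrKA (b *m w)); exact: combination_D.
  by move/(_ z); rewrite tv_mulE fz scale1r addrC addKr.
suff [m [c [f [Xf ->]]]] : combination (fun f => exists d, S (tv d f)) y.
  by have [d Sd] := fin_all_exists Xf; exists m, c, d, f.
pose Q (m : 'M[K]_n) := forall z : 'rV[K]_n,
  combination (fun f => exists d, S (tv d f)) (z *m m - z).
have /gen_SK_ind H : Q 1%:M.
  by move=> z; rewrite mulmx1 subrr; exists 0%N, (fun=> 0), (fun=> 0);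
    split=> [[]|]; rewrite ?big_ord0.
have [d d0 yd] := exists_vector_ker y; have [g gd] := app_eq1_l d0.
have : Q (tv d y).
  apply: H (SL_tv yd) => [e f l Se w|a b Qa Qb w].
    by rewrite mul_tvE addrC addKr; apply: combination_mem; exists e.
  rewrite mulmxA -[_ - _](subrKA (w *m a)); exact: combination_D.
by move/(_ g); rewrite mul_tvE gd scale1r addrC addKr.
Qed.

(** Let [U] be the common kernel of the forms of vertices not reachable from [r]. It contains the
    vectors of reachable vertices, and unreachable ones act trivially on it, so it is stable under
    the group. It is nonzero, and proper if [s] is unreachable, against irreducibility of SL. *)
Lemma P2_of_SL : P2 S.
Proof.
move=> r s [Sr r1] [Ss s1]; apply: NNPP => no.
pose reach := clos_refl_trans _ (gedge S) r.
pose U x := forall d f, S (tv d f) -> ~ reach (tv d f) -> app f x = 0.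
have reachU d f : S (tv d f) -> reach (tv d f) -> U d.
  move=> Sd rd d' f' Sd' nr; apply/eqP/negPn/negP=> fd; apply: nr.
  apply: rt_trans rd _; apply: rt_step; split; [exact: vertexP|exact: vertexP|].
  by exists d, f, d', f'.
have keep m : gen (SK S) m -> forall x, U x -> U (m *m x).
  move: m; apply: gen_SK_ind => [x|d f l Sd x Ux|a b Qa Qb x Ux].
  - by rewrite mul1mx.
  - rewrite tv_mulE; have [rd|nr] := classic (reach (tv d f)).
      have Ud := reachU _ _ Sd rd => d' f' Sd' nr'.
      by rewrite !appE (Ux _ _ Sd' nr') (Ud _ _ Sd' nr') !mulr0 addr0.
    by rewrite (Ux _ _ Sd nr) scale0r addr0.
  by rewrite -mulmxA; apply/Qa/Qb.
have [d0 [f0 [d00 f00 _ rE]]] := HS Sr; have [d1 [f1 [d10 f10 _ sE]]] := HS Ss.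
have Ud0 : U d0 by apply: (@reachU _ f0); rewrite -rE //; apply: rt_refl.
have kill x : U x -> app f1 x = 0 by move=> Ux; apply: (Ux d1); rewrite -sE.
have [y fy] := app_eq1_r f10; have [h hd] := app_eq1_l d00.
(* Chosen with t(y) = 0 and t(d0) = 1, so that [tv y t] moves [d0] to d0 + y, on which [f1] is 1. *)
pose t := h - app h y *: f1.
have ty : app t y = 0 by rewrite !appE fy mulr1 subrr.
have := kill _ (keep _ (SL_tv ty) _ Ud0).
rewrite tv_mulE !appE hd fy (kill _ Ud0) mulr0 subr0 add0r mulr1 => /eqP.
by rewrite oner_eq0.
Qed.

End Preservation.
End Converse.

(** * The invariant form of a symmetric graph *)

Section SymmetricGraph.
Variables (K : fieldType) (n : nat) (S : 'M[K]_n -> Prop).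
Hypotheses (n3 : (3 <= n)%N) (HS : forall t, S t -> is_transvection t).
Hypothesis p1 : P1 S.
Hypothesis p2 : P2 S.
Hypothesis gsym : forall r s, gedge S r s -> gedge S s r.
Hypothesis no_cycle : ~ P3 S.
Local Notation mat := 'M[K]_n.
Implicit Types (d e x y z : 'cV[K]_n) (f g : 'rV[K]_n) (r s t : mat).

(** A fixed choice of factors for each vertex, so that ratios become functions of matrices. *)
Definition factors t : 'cV[K]_n * 'rV[K]_n :=
  epsilon (inhabits (0, 0)) (fun p => t = tv p.1 p.2).
Local Notation vec t := (factors t).1.
Local Notation form t := (factors t).2.

Lemma factorsE t : S t -> tv (vec t) (form t) = t.
Proof.
move=> /HS[d [f [_ _ _ tE]]]; apply: esym.
by apply: (epsilon_spec (inhabits (0, 0)) (fun p => t = tv p.1 p.2)); exists (d, f).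
Qed.

Lemma factors_ok t : S t -> [/\ vec t != 0, form t != 0 & app (form t) (vec t) = 0].
Proof.
by move=> St; apply: transvectionP; rewrite factorsE //; apply: HS.
Qed.

Lemma factors_scale d f : S (tv d f) -> exists c,
  [/\ c != 0, d = c *: vec (tv d f) & f = c^-1 *: form (tv d f)].
Proof.
by move=> St; have [v0 f0 _] := factors_ok St; apply: tv_inj; rewrite ?factorsE.
Qed.

Lemma gedge_app r s : S r -> S s -> gedge S r s <-> app (form s) (vec r) != 0.
Proof.
move=> Sr Ss; split=> [[_ _ ed]|h].
  by apply: (@edge_tv _ _ _ (form r) (vec s)); rewrite !factorsE //; apply: HS.
rewrite -[r]factorsE // -[s]factorsE //; split.
- by apply: vertexP; rewrite ?factorsE.
- by apply: vertexP; rewrite ?factorsE.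
by exists (vec r), (form r), (vec s), (form s).
Qed.

Definition ratio r s : K := edge_ratio (factors r) (factors s).

Lemma gedge_nz r s : gedge S r s ->
  app (form s) (vec r) != 0 /\ app (form r) (vec s) != 0.
Proof.
move=> rs; have sr := gsym rs; have [[Sr _] [Ss _] _] := rs.
by split; apply/gedge_app.
Qed.

Lemma ratioV r s : gedge S r s -> ratio r s * ratio s r = 1.
Proof.
by case/gedge_nz=> h1 h2; rewrite /ratio /edge_ratio; field; rewrite h1.
Qed.

Local Notation gwalk := (walk (gedge S) ratio).

Lemma segment_walk (a : nat -> mat) k i j : (i <= j)%N -> (j <= k)%N ->
  (forall l, (l < k)%N -> gedge S (a l) (a l.+1)) ->
  gwalk (j - i) (a i) (a j) (\prod_(i <= l < j) ratio (a l) (a l.+1)).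
Proof.
move=> ij jk ea.
have -> : \prod_(i <= l < j) ratio (a l) (a l.+1) =
    \prod_(l < j - i) ratio (a (l + i)%N) (a (l + i).+1).
  by rewrite -{1}[i]add0n big_addn big_mkord.
have := @walk_fun _ _ (gedge S) ratio (j - i) (fun l => a (l + i)%N).
rewrite subnK // add0n; apply=> l; rewrite ltn_subRL addnC => lj.
by apply: ea; apply: leq_trans lj jk.
Qed.

(** A repeated vertex splits the walk into two shorter closed walks. With distinct vertices, length
    1 is excluded, length 2 gives inverse ratios, and length at least 3 is a cycle, whose
    singularity says that the product is 1. *)
Lemma closed_gwalk k r c : gwalk k r r c -> c = 1.
Proof.
elim/ltn_ind: k r c => k IH r c rr; have [a [a0 ak ea cE]] := fun_walk rr.
have [[i [j [ij jk aij]]]|inj] := classic (exists i j, [/\ (i < j)%N, (j < k)%N & a i = a j]).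
  have w1 := segment_walk (leq0n i) (ltnW (ltn_trans ij jk)) ea.
  have w2 := segment_walk (ltnW ij) (ltnW jk) ea.
  have w3 := segment_walk (ltnW jk) (leqnn k) ea.
  rewrite -aij in w2 w3; rewrite ak -a0 in w3.
  have e2 := IH _ (leq_ltn_trans (leq_subr _ _) jk) _ _ w2.
  have lk : (i - 0 + (k - j) < k)%N.
    by rewrite subn0 -ltn_subRL ltn_sub2l // (ltn_trans ij).
  have e13 := IH _ lk _ _ (walk_cat w1 w3).
  rewrite cE -(big_mkord xpredT (fun l => ratio (a l) (a l.+1))).
  rewrite (@big_cat_nat _ _ _ i) //=; last exact: ltnW (ltn_trans ij jk).
  rewrite (@big_cat_nat _ _ _ j i k) //=; [|exact: ltnW|exact: ltnW].
  by rewrite e2 mul1r.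
have {}inj i j : (i < k)%N -> (j < k)%N -> a i = a j -> i = j.
  move=> ik jk aij; case: (ltngtP i j) => // h; case: inj.
    by exists i, j.
  by exists j, i.
case: k => [|[|[|k]]] in IH rr a0 ak ea cE inj *.
- by rewrite cE big_ord0.
- have [[Sr _] _ _] := ea 0%N isT; have [] := gedge_nz (ea 0%N isT).
  by rewrite a0 ak in Sr *; case: (factors_ok Sr) => _ _ ->; rewrite eqxx.
- rewrite cE !big_ord_recr big_ord0 /= mul1r ak -a0; apply: ratioV; exact: (ea 0%N).
apply: NNPP => c1; apply: no_cycle.
have aS (i : 'I_k.+3) : a (ordS i) = a i.+1.
  have [ik|ik] := ltnP i.+1 k.+3; first by rewrite /= modn_small.
  have -> : i.+1 = k.+3 by apply/eqP; rewrite eqn_leq ik ltn_ord.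
  rewrite ak -a0; congr a; rewrite /= (_ : i.+1 = k.+3) ?modnn //.
  by apply/eqP; rewrite eqn_leq ik ltn_ord.
have Sa (i : 'I_k.+3) : S (a i) by case: (ea i (ltn_ord i)) => -[].
exists k.+3, (fun i => vec (a i)), (fun i => form (a i)); split=> //.
- by move=> i; rewrite factorsE //; case: (ea i (ltn_ord i)).
- by move=> i j; rewrite !factorsE // => /(inj _ _ (ltn_ord i) (ltn_ord j)) /val_inj.
- move=> i; rewrite !factorsE // aS; by case: (ea i (ltn_ord i)).
apply/eqP=> nz; apply: c1; rewrite cE.
under eq_bigr => i _ do rewrite /ratio /edge_ratio -aS.
rewrite prodrN card_ord big_split /= prodfV.
move: nz; set X := \prod_(i < _) app (form (a i)) _.
set Y := \prod_(i < _) _ => /eqP; rewrite addr_eq0 => /eqP XY.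
have X0 : X != 0.
  apply/prodf_neq0 => i _; rewrite aS.
  by have [] := gedge_nz (ea i (ltn_ord i)).
by rewrite exprS mulN1r mulNr mulrA -mulNr -XY divff.
Qed.

Variable base : mat.
Hypothesis Sbase : S base.

Definition potential t c := exists k, gwalk k base t c.

Lemma gwalk_rev k r s c : gwalk k r s c -> gwalk k s r c^-1.
Proof. by apply: walk_rev; [exact: gsym | exact: ratioV]. Qed.

Lemma potential_neq0 t c : potential t c -> c != 0.
Proof.
case=> k w; have := closed_gwalk (walk_cat w (gwalk_rev w)).
by apply: contra_eq_neq => ->; rewrite mul0r eq_sym oner_neq0.
Qed.

Lemma potential_uniq t c c' : potential t c -> potential t c' -> c = c'.
Proof.
move=> [k w] p'; have c'0 := potential_neq0 p'; have [k' w'] := p'.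
apply: (mulIf (invr_neq0 c'0)); rewrite divff //.
exact: closed_gwalk (walk_cat w (gwalk_rev w')).
Qed.

Lemma potential_edge r s c : gedge S r s -> potential r c ->
  potential s (c * ratio r s).
Proof.
move=> rs [k w]; exists (k + 1)%N; apply: walk_cat w _.
by exists s, 1; rewrite mulr1.
Qed.

Lemma potential_ex t : S t -> exists c, potential t c.
Proof.
move=> St.
have : clos_refl_trans _ (gedge S) base t.
  by rewrite -(factorsE Sbase) -(factorsE St); apply: connected; rewrite ?factorsE.
have : exists c, potential base c by exists 1, 0%N.
move=> + bt; elim: bt => [r s rs [c pc]||r s u _ h1 _ h2 /h1/h2] //.
by exists (c * ratio r s); apply: potential_edge.
Qed.

(** Along an edge the potentials differ by the ratio, whose definition is this equation; without an
    edge both pairings vanish by symmetry of the graph. *)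
Lemma potential_skew r s c c' : S r -> S s -> potential r c -> potential s c' ->
  c'^-1 * app (form s) (vec r) = - (c^-1 * app (form r) (vec s)).
Proof.
move=> Sr Ss pr ps; have c0 := potential_neq0 pr; have c0' := potential_neq0 ps.
have [z|nz] := eqVneq (app (form s) (vec r)) 0.
  have [->|nz'] := eqVneq (app (form r) (vec s)) 0; first by rewrite z !mulr0 oppr0.
  by have := gedge_nz (proj2 (gedge_app Ss Sr) nz') => -[_]; rewrite z eqxx.
have rs : gedge S r s by apply/gedge_app.
have [_ nz'] := gedge_nz rs.
have := potential_uniq ps (potential_edge rs pr).
rewrite /ratio /edge_ratio => ->; field.
by rewrite oppr_eq0 c0 nz nz'.
Qed.

(* [psi] is the contraction of [x] with the alternating form for which
   [v_t] contracts to [c_t^-1 phi_t]. *)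
Definition dual_to x (psi : 'rV[K]_n) := forall t c, S t -> potential t c ->
  app psi (vec t) = - (c^-1 * app (form t) x).

Lemma dual_to_D x y f g : dual_to x f -> dual_to y g -> dual_to (x + y) (f + g).
Proof.
by move=> xf yg t c St pt; rewrite !appE (xf t c) // (yg t c) //; ring.
Qed.

Lemma dual_to_Z a x f : dual_to x f -> dual_to (a *: x) (a *: f).
Proof. by move=> xf t c St pt; rewrite !appE (xf t c) //; ring. Qed.

Lemma dual_to_0 : dual_to 0 0.
Proof. by move=> t c _ _; rewrite app0l app0r mulr0 oppr0. Qed.

Lemma dual_to_vec t c : S t -> potential t c -> dual_to (vec t) (c^-1 *: form t).
Proof.
move=> St pt s c' Ss ps; rewrite appE; exact: potential_skew.
Qed.

Lemma dual_to_ex x : exists f, dual_to x f.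
Proof.
have [m [c [d [f [Sdf ->]]]]] := p1.1 x.
elim/big_ind: _ => [|y z [g yg] [h zh]|i _].
- by exists 0; apply: dual_to_0.
- by exists (g + h); apply: dual_to_D.
have [a [a0 -> _]] := factors_scale (Sdf i).
have [b pb] := potential_ex (Sdf i).
by eexists; do 2! apply: dual_to_Z; apply: dual_to_vec pb.
Qed.

Lemma dual_to_uniq x f g : dual_to x f -> dual_to x g -> f = g.
Proof.
move=> xf xg; apply/eqP; rewrite -subr_eq0; apply/negPn/negP.
case/(form_meets_S p1)=> d [h [Sdh]].
have [a [a0 -> _]] := factors_scale Sdh; have [b pb] := potential_ex Sdh.
by rewrite !appE (xf _ _ Sdh pb) (xg _ _ Sdh pb) subrr mulr0 eqxx.
Qed.

Lemma not_SL_of_symmetric : ~ generates_SL (SK S).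
Proof.
move=> gS.
have [F Fdual] := fin_all_exists (fun j : 'I_n => dual_to_ex (delta_mx j 0)).
(* Chosen on the standard basis and extended linearly; the pairing [app (B x) y] is the invariant
   bilinear form. *)
pose B x := x^T *m \matrix_j F j.
have BD x y : B (x + y) = B x + B y by rewrite /B linearD mulmxDl.
have BZ a x : B (a *: x) = a *: B x by rewrite /B linearZ -scalemxAl.
have Bdual x : dual_to x (B x).
  have -> : x = \sum_j x j 0 *: delta_mx j 0.
    by rewrite [LHS]matrix_sum_delta; apply: eq_bigr => i _; rewrite big_ord1.
  elim/big_ind: _ => [|y z By Bz|i _]; last 1 first.
  - rewrite BZ; apply: dual_to_Z; suff -> : B (delta_mx i 0) = F i by [].
    by rewrite /B trmx_delta -rowE rowK.
  - by rewrite /B trmx0 mul0mx; apply: dual_to_0.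
  by rewrite BD; apply: dual_to_D.
have Bvec t c : S t -> potential t c -> B (vec t) = c^-1 *: form t.
  by move=> St pt; apply: dual_to_uniq (Bdual _) (dual_to_vec St pt).
have keep m : gen (SK S) m -> forall x y, app (B (m *m x)) (m *m y) = app (B x) y.
  move: m; apply: (gen_SK_ind HS) => [x y|d f l Sd x y|a b Qa Qb x y].
  - by rewrite !mul1mx.
  - have := factors_scale Sd; move: (tv d f) Sd => t St [a [a0 -> ->]].
    have [c pc] := potential_ex St; have [_ _ fv] := factors_ok St.
    rewrite !tv_mulE !BD !BZ (Bvec _ _ St pc) !appE (Bdual x _ _ St pc) fv.
    by ring.
  by rewrite -!mulmxA Qa Qb.
have [v0 f0 _] := factors_ok Sbase; have [c pc] := potential_ex Sbase.
(* Here n >= 3 enters: [h] kills both [vec base] and [y], so [tv y h] fixes [vec base] and sends z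
   to z + y. Invariance then forces the form to vanish on (vec base, y), where its value is the
   inverse of a potential. *)
have [y fy] := app_eq1_r f0; have [h h0 [hv hy]] := exists_form_ker2 n3 (vec base) y.
have [z hz] := app_eq1_r h0.
have := keep _ (SL_tv gS hy) (vec base) z.
rewrite !tv_mulE hv hz scale0r addr0 scale1r appDr => /eqP.
rewrite -subr_eq0 addrAC subrr add0r (Bvec _ _ Sbase pc) appE fy mulr1.
by rewrite invr_eq0 (negbTE (potential_neq0 pc)).
Qed.

End SymmetricGraph.

Theorem theorem5p1 (K : fieldType) (n : nat) (Hn : (3 <= n)%N)
  (S : 'M[K]_n -> Prop) (HS : forall t, S t -> is_transvection t) :
  generates_SL (SK S) <->
  ((P1 S /\ P2 S /\ P3 S) \/ (P1 S /\ P2 S /\ P3' S)).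
Proof.
split=> [gS|]; last first.
  have oneway : P1 S -> P2 S -> oneway_roots (SK S) -> generates_SL (SK S).
    move=> p1 p2 [[d f] [[d' f'] [[/= r _ f0] [/= r' d0 _] n0 e0]]].
    exact: (generates_of_oneway HS p1 p2 r r').
  by case=> -[p1 [p2 p3]]; apply: oneway => //;
    [apply: oneway_of_P3 | apply: oneway_of_P3'].
have p1 := P1_of_SL Hn HS gS; have p2 := P2_of_SL HS gS.
have [p3|np3] := classic (P3 S); [by left | right; split=> //; split=> //].
apply: NNPP => np3'.
(* A one-way edge of [S] itself gives P3' through the empty chain of equivalences. *)
have gsym r s : gedge S r s -> gedge S s r.
  move=> rs; apply: NNPP => sr; apply: np3'; exists S.
  by split; [apply: rt_refl | exists r, s].
(* Any nonzero form will do: by P1 it meets a vector of [S], which provides the base vertex of the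
   potential. *)
have f0 : (delta_mx 0 (Ordinal (ltnW (ltnW Hn))) : 'rV[K]_n) != 0.
  by apply/rV0Pn; exists (Ordinal (ltnW (ltnW Hn))); rewrite mxE !eqxx oner_neq0.
have [d [g [Sd _]]] := form_meets_S p1 f0.
exact: (not_SL_of_symmetric Hn HS p1 p2 gsym np3 Sd).
Qed.
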